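(* Let $m\ge 5$, let $D(p)$ be the rank difference function associated with the family of finite tilings $(G_t(m))_{t\ge m}$, and define $$p_h=\sup\left\{p\in[0,1] : p-\frac{2}{m}+D(p)=0\right\}.$$ Then $p_c(G(m))\le p_h$.
   Context: **Infinite graph and critical probability.** For $m\ge 5$, $G(m)$ is the infinite planar graph that is $m$-regular and tiles the (hyperbolic) plane by faces of length $m$. In bond percolation with parameter $p\in[0,1]$, each edge is independently open with probability $p$ and closed otherwise. For a fixed edge $e$ of $G(m)$, let $f(p)$ be the probability that $e$ belongs to an infinite connected component of the open subgraph (independent of $e$ by edge-transitivity). The critical probability $p_c(G(m))$ is the supremum of the set of $p$ with $f(p)=0$. **Tilings.** A tiling $G=(V,E,F)$ of a surface is a graph $(V,E)$ cellularly embedded in a smooth surface, $F$ being its set of faces; a face is identified with the set of edges on its boundary. Its dual tiling $G^*=(V^*,E^*,F^* )$ has $V^*=F$; each edge of $E$ lies in exactly two faces and gives an edge of $E^*$ joining these two faces, so $E$ and $E^*$ are identified; the faces of $G^*$ correspond to the vertices of $G$. The graph and its dual have no loops or multiple edges. **Finite tilings.** $(G_t(m))_{t\ge m}$, $G_t(m)=(V_t,E_t,F_t)$, also written $G_t$, is a fixed family of finite connected tilings of surfaces (Širáň's family) obtained as coset tilings of finite quotients $\bar T$ (reductions modulo suitable primes of a matrix representation) of $T(m)=\langle a,b\mid a^m=b^m=(ab)^2=1\rangle$: vertices, edges and faces are the left cosets of $\langle a\rangle$, $\langle ab\rangle$, $\langle b\rangle$ in $\bar T$, incidence being non-empty intersection.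 These tilings are $m$-regular with all faces of length $m$; vertex-, edge- and face-transitive; self-dual; every ball of radius $t$ of $G_t(m)$ is isomorphic (as a piece of a tiling, i.e. respecting vertices, edges and faces) to every ball of radius $t$ in $G(m)$; and there is a constant $K$ such that $|V_t|\le K^t$ for all $t$. **Rank difference function.** For $\varepsilon\subset E_t$, let $\bar\varepsilon=E_t\setminus\varepsilon$; $G_{t,\varepsilon}$ is the subgraph of $G_t$ with vertex set $V_t$ and edge set $\varepsilon$, and $G^*_{t,\bar\varepsilon}$ is the subgraph of $G_t^*$ with vertex set $V_t^*$ and edge set $\bar\varepsilon$ (regarded as a subset of $E_t^*$). The rank of a graph is the rank over $\mathbb{F}_2$ of its vertex-edge incidence matrix. Let $\mathbb{E}_p$ be expectation when $\varepsilon$ contains each edge of $E_t$ independently with probability $p$. Then $$D(p)=\limsup_{t\to\infty}\mathbb{E}_p\left(\frac{\operatorname{rank}G^*_{t,\bar\varepsilon}-\operatorname{rank}G_{t,\varepsilon}}{|E_t|}\right).$$ *)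

(* Defs.v *)
From HB Require Import structures.
From mathcomp Require Import all_boot all_order all_algebra all_fingroup.
From mathcomp Require Import all_classical all_reals all_analysis.

Set Implicit Arguments.
Unset Strict Implicit.
Unset Printing Implicit Defensive.

Import Order.TTheory GRing.Theory Num.Theory.

Local Open Scope classical_set_scope.
Local Open Scope card_scope.
Local Open Scope ring_scope.

(* [endpoint x e]: the vertex x is an end of the edge e.
   [side f e]: the edge e is on the boundary of the face f; a face is thus
   given by its set of boundary edges. *)
Record tiling (V E F : choiceType) := Tiling {
  endpoint : V -> E -> bool;
  side : F -> E -> bool }.

(* The edges are kept; the faces of the dual are the vertices of G. *)
Definition dual (V E F : choiceType) (G : tiling V E F) : tiling F E V :=
  Tiling (side G) (endpoint G).

Section Tilings.
Variables (V E F : choiceType) (G : tiling V E F).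

Definition simple_graph : Prop :=
  (forall e, exists u v, u != v /\
     forall w, endpoint G w e = (w == u) || (w == v)) /\
  (forall e e' u v, u != v -> endpoint G u e -> endpoint G v e ->
     endpoint G u e' -> endpoint G v e' -> e = e').

Definition adj_in (S : set E) : rel V := fun u v =>
  (u != v) && `[< exists2 e, S e & endpoint G u e && endpoint G v e >].

Definition adj : rel V := adj_in setT.

Definition connected_tiling : Prop :=
  forall u v, exists2 s, path.path adj u s & last u s = v.

(* The edges of f form an embedded cycle visiting the vertices c in order. *)
Definition boundary_cycle (f : F) (c : seq V) : Prop :=
  [/\ (2 < size c)%N, uniq c,
      path.cycle (adj_in [set e | side G f e]) c
    & forall e, side G f e ->
        exists2 u, u \in c & endpoint G u e && endpoint G (path.next c u) e].

(* Homotopy of walks, given by the list of their vertices: one may erase a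
   backtracking u v u, or a turn around the boundary of a face. *)
Inductive homotopic : seq V -> seq V -> Prop :=
| homotopic_refl s : homotopic s s
| homotopic_sym s s' : homotopic s s' -> homotopic s' s
| homotopic_trans s s' s'' :
    homotopic s s' -> homotopic s' s'' -> homotopic s s''
| homotopic_backtrack s s' u v : adj u v ->
    homotopic (s ++ [:: u, v, u & s']) (s ++ u :: s')
| homotopic_face s s' u c f : boundary_cycle f (u :: c) ->
    homotopic (s ++ (u :: c) ++ u :: s') (s ++ u :: s').

Definition simply_connected_tiling : Prop :=
  forall u s, path.path adj u s -> last u s = u ->
    homotopic (u :: s) [:: u].

Definition regular_tiling (m : nat) : Prop :=
  forall x, [set e | endpoint G x e] #= `I_m.

Definition faces_of_length (m : nat) : Prop :=
  forall f, [set e | side G f e] #= `I_m.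

Definition ball_vertices (x : V) (r : nat) : set V :=
  [set y | exists s, [/\ path.path adj x s, last x s = y & (size s <= r)%N]].

Definition ball_edges (x : V) (r : nat) : set E :=
  [set e | forall y, endpoint G y e -> ball_vertices x r y].

Definition ball_faces (x : V) (r : nat) : set F :=
  [set f | forall e, side G f e -> ball_edges x r e].

(* The vertices joined to x by a path of edges in S. *)
Definition component (S : set E) (x : V) : set V :=
  [set y | exists2 s, path.path (adj_in S) x s & last x s = y].

Definition in_infinite_component (S : set E) (e : E) : Prop :=
  S e /\ exists2 x, endpoint G x e & infinite_set (component S x).

End Tilings.

(* Combinatorial form of a cellular embedding of a graph in a surface. That G
   is simple as well as its dual says in particular that each edge is in exactly
   two faces. That the faces around each vertex, i.e. the boundary of a face of
   the dual, form a single cycle says that the cell complex is a surface. *)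
Definition surface_tiling (V E F : choiceType) (G : tiling V E F) : Prop :=
  [/\ simple_graph G, simple_graph (dual G), connected_tiling G,
      forall f, exists c, boundary_cycle G f c
    & forall x, exists c, boundary_cycle (dual G) x c].

(* A surface tiled by finite faces is the plane if and only if it is simply
   connected and not compact, i.e. has infinitely many cells. *)
Definition plane_tiling (V E F : choiceType) (G : tiling V E F) : Prop :=
  [/\ surface_tiling G, simply_connected_tiling G & infinite_set [set: V]].

(* G is the tiling G(m), which is unique up to isomorphism. *)
Definition hyperbolic_tiling (m : nat) (V E F : choiceType)
    (G : tiling V E F) : Prop :=
  [/\ plane_tiling G, regular_tiling G m & faces_of_length G m].

Section Isomorphisms.
Variables (V E F V' E' F' : choiceType).
Variables (G : tiling V E F) (G' : tiling V' E' F').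

(* Isomorphism from the piece (A, B, C) of G, made of vertices, edges and
   faces, to the piece (A', B', C') of G'. *)
Definition piece_isomorphism (A : set V) (B : set E) (C : set F)
    (A' : set V') (B' : set E') (C' : set F')
    (h : V -> V') (k : E -> E') (l : F -> F') : Prop :=
  [/\ set_bij A A' h, set_bij B B' k, set_bij C C' l,
      forall x e, A x -> B e -> endpoint G' (h x) (k e) = endpoint G x e
    & forall f e, C f -> B e -> side G' (l f) (k e) = side G f e].

Definition isomorphism : (V -> V') -> (E -> E') -> (F -> F') -> Prop :=
  piece_isomorphism setT setT setT setT setT setT.

Definition isomorphic_balls (r : nat) (x : V) (x' : V') : Prop :=
  exists h k l, piece_isomorphism
    (ball_vertices G x r) (ball_edges G x r) (ball_faces G x r)
    (ball_vertices G' x' r) (ball_edges G' x' r) (ball_faces G' x' r) h k l.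

End Isomorphisms.

Definition self_dual (V E F : choiceType) (G : tiling V E F) : Prop :=
  exists h k l, isomorphism G (dual G) h k l.

Definition vertex_transitive (V E F : choiceType) (G : tiling V E F) : Prop :=
  forall x y, exists h k l, isomorphism G G h k l /\ h x = y.

Definition edge_transitive (V E F : choiceType) (G : tiling V E F) : Prop :=
  forall x y, exists h k l, isomorphism G G h k l /\ k x = y.

Definition face_transitive (V E F : choiceType) (G : tiling V E F) : Prop :=
  forall x y, exists h k l, isomorphism G G h k l /\ l x = y.

Definition left_coset (gT : finGroupType) (H : {set gT}) : finType :=
  {A : {set gT} | A \in lcosets H [set: gT]%SET}.

Definition coset_tiling (gT : finGroupType) (a b : gT) :
    tiling (left_coset <[a]>%g) (left_coset <[(a * b)%g]>%g)
           (left_coset <[b]>%g) :=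
  Tiling (fun x e => (val x :&: val e)%SET != finset.set0)
         (fun f e => (val f :&: val e)%SET != finset.set0).

(* gT is a quotient of T(m) = <a, b | a^m = b^m = (ab)^2 = 1>, with a and b the
   images of the two generators. *)
Definition triangle_quotient (m : nat) (gT : finGroupType) (a b : gT) : Prop :=
  [/\ <<[set a; b]%SET>>%g = [set: gT]%SET,
      (a ^+ m = 1)%g, (b ^+ m = 1)%g & ((a * b) ^+ 2 = 1)%g].

(* The tilings for t < m are unconstrained; they do not affect the limsup below. *)
Record approximating_family (m : nat) (V E F : choiceType) (G : tiling V E F)
    (gT : nat -> finGroupType) (a b : forall t, gT t) : Prop := {
  approx_quotient : forall t, (m <= t)%N -> triangle_quotient m (a t) (b t);
  approx_surface : forall t, (m <= t)%N ->
    surface_tiling (coset_tiling (a t) (b t));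
  approx_regular : forall t, (m <= t)%N ->
    regular_tiling (coset_tiling (a t) (b t)) m;
  approx_faces : forall t, (m <= t)%N ->
    faces_of_length (coset_tiling (a t) (b t)) m;
  approx_vertex_transitive : forall t, (m <= t)%N ->
    vertex_transitive (coset_tiling (a t) (b t));
  approx_edge_transitive : forall t, (m <= t)%N ->
    edge_transitive (coset_tiling (a t) (b t));
  approx_face_transitive : forall t, (m <= t)%N ->
    face_transitive (coset_tiling (a t) (b t));
  approx_self_dual : forall t, (m <= t)%N ->
    self_dual (coset_tiling (a t) (b t));
  approx_balls : forall t, (m <= t)%N -> forall x y,
    isomorphic_balls (coset_tiling (a t) (b t)) G t x y;
  approx_card : exists K : nat, forall t, (m <= t)%N ->
    (#|left_coset <[a t]>%g| <= K ^ t)%N }.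

(* Rank over F_2 of the incidence matrix of the graph with all the vertices of
   G and with set of edges S. *)
Definition graph_rank (V E F : finType) (G : tiling V E F) (S : {set E}) : nat :=
  \rank (\matrix_(i < #|V|, j < #|S|)
           (endpoint G (enum_val i) (enum_val j))%:R : 'M['F_2]_(#|V|, #|S|)).

(* Expectation of X(S) when S contains each element of E independently with
   probability p. *)
Definition expect_subset (R : realType) (E : finType) (p : R)
    (X : {set E} -> R) : R :=
  \sum_(S : {set E}) p ^+ #|S| * (1 - p) ^+ #|(~: S)%SET| * X S.

Definition rank_difference (R : realType)
    (gT : nat -> finGroupType) (a b : forall t, gT t) (p : R) : R :=
  limn_sup (fun t : nat =>
    let G := coset_tiling (a t) (b t) in
    expect_subset p (fun S : {set left_coset <[(a t * b t)%g]>%g} =>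
      ((graph_rank (dual G) (~: S)%SET)%:R - (graph_rank G S)%:R)
        / #|left_coset <[(a t * b t)%g]>%g|%:R)).

Definition homological_threshold (R : realType) (m : nat)
    (gT : nat -> finGroupType) (a b : forall t, gT t) : R :=
  sup [set p : R | 0 <= p <= 1 /\ p - 2 / m%:R + rank_difference a b p = 0].

Definition bond_percolation (R : realType) (d : measure_display)
    (Omega : measurableType d) (P : probability Omega R) (E : choiceType)
    (opened : Omega -> set E) (p : R) : Prop :=
  [/\ forall e, measurable [set w | opened w e],
      forall e, P [set w | opened w e] = p%:E
    & forall s : seq E, uniq s ->
        P (\big[setI/setT]_(e <- s) [set w | opened w e])
        = (\prod_(e <- s) P [set w | opened w e])%E].

(* P p is the law of the percolation with parameter p. *)
Definition critical_probability (R : realType) (d : measure_display)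
    (Omega : measurableType d) (P : R -> probability Omega R)
    (V E F : choiceType) (G : tiling V E F) (opened : Omega -> set E) (e : E) : R :=
  sup [set p : R | 0 <= p <= 1 /\
         P p [set w | in_infinite_component G (opened w) e] = 0%E].

(* Main.v *)
Require Import Defs.
From mathcomp Require Import all_boot all_order all_algebra all_fingroup.
From mathcomp Require Import all_classical all_reals all_analysis.
From mathcomp Require Import ring lra zify.

Set Implicit Arguments.
Unset Strict Implicit.
Unset Printing Implicit Defensive.

Import Order.TTheory GRing.Theory Num.Theory.
Import numFieldNormedType.Exports.

Local Open Scope classical_set_scope.
Local Open Scope ring_scope.

(** Let [S] be a set of edges of a finite tiling, with vertices [V], edges [E] and
    faces [F], and let [h(S)] be the dimension over F_2 of the cycles of [S] modulo
    those that are sums of faces. The cycles of [S] form a space of dimension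
    [|S| - rank G_S]. A set of faces has its boundary in [S] when no edge outside
    of [S] separates it from its complement, so that the boundaries in [S] form a
    space of dimension [|F| - rank G*_(~S) - 1], where 1 accounts for the set of
    all faces. Hence [rank G*_(~S) - rank G_S = |F| - |S| - 1 + h(S)]. As
    [m |F| = 2 |E|], dividing by [|E|] and taking expectations gives
    [2/m - p + (E_p h(S) - 1) / |E|]: the equation [p - 2/m + D(p) = 0] holds as
    soon as [|E|] tends to infinity and [E_p h(S)] is negligible before [|E|].
    The inequalities on ranks which are used are [rank_gap_lower] and
    [rank_gap_upper].

    Suppose now that [e] is almost surely not in an infinite component. Say that
    an open edge escapes if a self-avoiding open walk of length [n] starts at one
    of its ends. A cycle without escaping edges is a sum of closed walks
    ([cycle_filling]), each of which stays in a ball of radius [n]. For large [t]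
    the surrounding ball of radius [t] is a copy of a ball of [G], where the walk
    is a sum of faces because [G] is simply connected ([homotopic_chain],
    [ball_filling]). So [h(S)] is at most the number of escaping edges
    ([homology_bounds]). Each edge of the finite tiling escapes with at most the
    probability that [e] escapes in [G] ([rooted_ball_isomorphism],
    [expect_escape_le]), which tends to 0 with [n], since an edge which escapes for
    all [n] is in an infinite component ([escape_cvg0]).

    Therefore each [p] at which infinite components have probability 0 belongs to
    the set whose supremum is the homological threshold. *)

(** * Walks, their edges modulo 2, and homotopy *)

Section Walks.
Variables (V E F : choiceType) (G : tiling V E F).

Definition joins (u v : V) (e : E) : bool :=
  [&& u != v, endpoint G u e & endpoint G v e].

(** The mod 2 chain of edges of the walk [u :: s]. A step that is not an edge
    counts for nothing, so that no choice of edges is needed. *)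
Fixpoint trace (u : V) (s : seq V) (e : E) : bool :=
  if s is v :: s' then joins u v e (+) trace v s' e else false.

Definition chain (s : seq V) : E -> bool :=
  if s is u :: s' then trace u s' else xpred0.

Fixpoint edge_walk (u : V) (s : seq V) (es : seq E) : bool :=
  match s, es with
  | [::], [::] => true
  | v :: s', e :: es' => joins u v e && edge_walk v s' es'
  | _, _ => false
  end.

Lemma joinsC u v e : joins u v e = joins v u e.
Proof. by rewrite /joins eq_sym; case: (v == u) => //=; rewrite andbC. Qed.

Lemma adj_inP (S : set E) u v :
  reflect (exists2 e, S e & joins u v e) (adj_in G S u v).
Proof.
apply: (iffP andP) => [[uv /asboolP[e Se uve]]|[e Se /andP[uv uve]]].
  by exists e => //; rewrite /joins uv.
by split=> //; apply/asboolP; exists e.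
Qed.

Lemma adjP u v : reflect (exists e, joins u v e) (adj G u v).
Proof.
by apply: (iffP (adj_inP _ _ _)) => -[e]; [move=> _ ?|move=> ?]; exists e.
Qed.

Lemma adj_in_sym (S : set E) : symmetric (adj_in G S).
Proof.
move=> u v; apply/adj_inP/adj_inP => -[e Se uve]; exists e => //;
  by rewrite joinsC.
Qed.

Lemma path_adj_in_sub (S T : set E) x s : S `<=` T ->
  path.path (adj_in G S) x s -> path.path (adj_in G T) x s.
Proof.
move=> ST; apply: sub_path => u v /adj_inP[e Se uve].
by apply/adj_inP; exists e => //; apply: ST.
Qed.

Lemma path_edge_walk (S : set E) x s : path.path (adj_in G S) x s <->
  exists2 es, edge_walk x s es & {in es, forall e, S e}.
Proof.
split.
  elim: s x => [|v s IH] x /=; first by exists [::].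
  move=> /andP[/adj_inP[e Se xve] /IH[es ves esS]].
  exists (e :: es); first by rewrite /= xve.
  by move=> e'; rewrite inE => /orP[/eqP->//|/esS].
elim: s x => [|v s IH] x //= -[[|e es]]//= /andP[xve ves] esS.
apply/andP; split; first by apply/adj_inP; exists e => //; apply: esS; rewrite mem_head.
by apply: IH; exists es => // e' ee'; apply: esS; rewrite inE ee' orbT.
Qed.

Lemma trace_cat u s s' e :
  trace u (s ++ s') e = trace u s e (+) trace (last u s) s' e.
Proof. by elim: s u => [|v s IH] u //=; rewrite IH addbA. Qed.

Lemma trace_rev u s e :
  trace (last u s) (rev (belast u s)) e = trace u s e.
Proof.
elim: s u => [|v s IH] u //=.
rewrite rev_cons -cats1 trace_cat IH.
have -> : last (last v s) (rev (belast v s)) = v.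
  by case: s {IH} => [|w s] //=; rewrite rev_cons last_rcons.
by rewrite /= addbF addbC joinsC.
Qed.

Lemma chain_cat s u s' e :
  chain (s ++ u :: s') e = chain (rcons s u) e (+) chain (u :: s') e.
Proof.
case: s => [|x s] //=; rewrite -cats1 !trace_cat /= addbF.
by rewrite -!addbA.
Qed.

Lemma trace_sum x s e : trace x s e =
  \big[addb/false]_(i < size s) joins (nth x (x :: s) i) (nth x s i) e.
Proof.
have H y : trace y s e =
  \big[addb/false]_(i < size s) joins (nth x (y :: s) i) (nth x s i) e.
  elim: s y => [|v s IH] y; first by rewrite big_ord0.
  by rewrite /= big_ord_recl /= IH.
exact: H.
Qed.

Hypothesis simpleG : simple_graph G.

Lemma joins_uniq u v e e' : joins u v e -> joins u v e' -> e = e'.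
Proof.
move=> /and3P[uv ue ve] /and3P[_ ue' ve'].
exact: (simpleG.2 e e' u v uv).
Qed.

Lemma joins_endpoint u v e w : joins u v e ->
  endpoint G w e = (w == u) || (w == v).
Proof.
move=> /and3P[uv ue ve]; have [x [y [xy H]]] := simpleG.1 e.
move: ue ve; rewrite !H.
by move=> /orP[]/eqP uE /orP[]/eqP vE; subst u v; rewrite ?eqxx// in uv *; rewrite orbC.
Qed.

Lemma edge_joins e : exists u v, joins u v e.
Proof.
have [u [v [uv H]]] := simpleG.1 e; exists u, v.
by rewrite /joins uv !H !eqxx orbT.
Qed.

Lemma joins_swap u v u' v' e : joins u v e -> joins u' v' e ->
  (u' = u /\ v' = v) \/ (u' = v /\ v' = u).
Proof.
move=> uv /and3P[u'v' u'e v'e].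
move: u'e v'e u'v'; rewrite !(joins_endpoint _ uv).
by move=> /orP[]/eqP-> /orP[]/eqP->; rewrite ?eqxx//; [left|right].
Qed.

(** This is where the length of a boundary cycle, at least 3, matters: its
    edges are pairwise distinct. *)
Lemma next_next_neq (T : eqType) (c : seq T) u :
  uniq c -> (2 < size c)%N -> u \in c -> path.next c (path.next c u) != u.
Proof.
move=> Uc sc /rot_to[i s' rE].
rewrite -!(next_rot i Uc).
move: Uc sc; rewrite -(rot_uniq i) -(size_rot i) rE.
case: s' {rE} => [|x [|y s']] //= /and3P[].
rewrite !inE eqxx !negb_or => /and3P[ux uy _] /andP[xy _] _ _.
by rewrite (eq_sym x u) (negbTE ux) eqxx eq_sym.
Qed.

(** A turn around a face uses each edge of the face exactly once: the edge from
    [v] to its successor could only recur as the edge from the successor back to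
    [v]. *)
Lemma boundary_cycle_chain f u c e : boundary_cycle G f (u :: c) ->
  chain (rcons (u :: c) u) e = side G f e.
Proof.
move=> [sc Uc Cc Hc].
have -> : chain (rcons (u :: c) u) e =
    \big[addb/false]_(v <- u :: c) joins v (path.next (u :: c) v) e.
  rewrite /= trace_sum size_rcons (big_nth u) big_mkord /=.
  apply: eq_bigr => i _.
  have -> : nth u (u :: rcons c u) i = nth u (u :: c) i.
    rewrite -rcons_cons nth_rcons /=.
    by rewrite ltn_ord.
  congr (joins _ _ e).
  change (nth u (rcons c u) i = path.next (u :: c) (nth u (u :: c) i)).
  rewrite next_nth mem_nth // index_uniq // nth_rcons.
  case: (ltnP i (size c)) => // ci; rewrite [RHS]nth_default //; by case: ifP.
have next_adj v : v \in u :: c ->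
    exists2 e', side G f e' & joins v (path.next (u :: c) v) e'.
  by move=> vc; apply/adj_inP/(next_cycle Cc).
case: (boolP (side G f e)) => [fe|nfe]; last first.
  rewrite big_seq big1 // => v vc; apply/negP => ve.
  have [e' fe' ve'] := next_adj v vc.
  by move: nfe; rewrite (joins_uniq ve ve') fe'.
have [v vc /andP[ve nve]] := Hc e fe.
have [e' fe' ve'] := next_adj v vc.
have vne : joins v (path.next (u :: c) v) e.
  by rewrite /joins ve nve; move: ve' => /andP[->].
rewrite (bigD1_seq v) //= -/(path.next (u :: c) v) vne.
rewrite big_seq_cond big1 // => w /andP[wc wv]; apply/negP => we.
have [[wE]|[wE wE']] := joins_swap vne we; first by rewrite wE eqxx in wv.
by have /eqP := next_next_neq Uc sc vc; rewrite -wE; apply.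
Qed.

Definition face_parity (fs : seq F) (e : E) : bool := odd (count (side G ^~ e) fs).

(** Homotopic closed walks are homologous: a backtrack adds an edge twice, and
    a turn around a face adds the boundary of this face. *)
Lemma homotopic_chain s s' : homotopic G s s' ->
  exists fs, forall e, chain s e = chain s' e (+) face_parity fs e.
Proof.
elim.
- by move=> t; exists [::] => e; rewrite /face_parity /= addbF.
- by move=> t t' _ [fs H]; exists fs => e; rewrite H -addbA addbb addbF.
- move=> t t' t'' _ [fs H] _ [fs' H']; exists (fs' ++ fs) => e.
  by rewrite H H' /face_parity count_cat oddD addbA.
- move=> t t' u v uv; exists [::] => e.
  rewrite /face_parity /= addbF !chain_cat /=.
  by rewrite (joinsC v u) [in LHS](addbA (joins u v e)) addbb.
- move=> t t' u c f fc; exists [:: f] => e.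
  rewrite /face_parity /= addn0 oddb -(boundary_cycle_chain e fc).
  rewrite !chain_cat -(addbA _ (chain (u :: t') e)) [chain (u :: t') e (+) _]addbC.
  by rewrite -(chain_cat (u :: c) u t').
Qed.

End Walks.

(** * Finite balls, and filling of closed walks *)

Section Balls.
Variables (V E F : choiceType) (G : tiling V E F).

Lemma ball_vertices_le x r r' : (r <= r')%N ->
  ball_vertices G x r `<=` ball_vertices G x r'.
Proof.
move=> rr' y [s [ps ls ss]]; exists s; split=> //; exact: leq_trans rr'.
Qed.

Lemma ball_edges_le x r r' : (r <= r')%N ->
  ball_edges G x r `<=` ball_edges G x r'.
Proof. by move=> rr' e He y /He; exact: ball_vertices_le. Qed.

Lemma ball_faces_le x r r' : (r <= r')%N ->
  ball_faces G x r `<=` ball_faces G x r'.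
Proof. by move=> rr' f Hf y /Hf; exact: ball_edges_le. Qed.

Lemma ball_vertices_center x r : ball_vertices G x r x.
Proof. by exists [::]. Qed.

Lemma ball_vertices_step x r y z : ball_vertices G x r y -> adj G y z ->
  ball_vertices G x r.+1 z.
Proof.
move=> [s [ps ls ss]] yz; exists (rcons s z).
by rewrite rcons_path ps ls yz last_rcons size_rcons.
Qed.

Lemma ball_verticesS x r z : ball_vertices G x r.+1 z ->
  ball_vertices G x r z \/ exists2 y, ball_vertices G x r y & adj G y z.
Proof.
move=> [s [+ + +]]; case/lastP: s => [|s v]; first by left; exists [::].
rewrite rcons_path last_rcons size_rcons => /andP[ps lv] vz ss; right.
by exists (last x s); [exists s|rewrite -vz].
Qed.

Lemma trace_mem x s e : trace G x s e ->
  exists u v, [/\ u \in x :: s, v \in x :: s & joins G u v e].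
Proof.
elim: s x => [|v s IH] x //=; case xve : (joins G x v e) => /=.
  by move=> _; exists x, v; rewrite !inE !eqxx orbT.
move=> /IH[u [w [us ws uwe]]]; exists u, w; split=> //;
  by rewrite inE (us, ws) orbT.
Qed.

Hypothesis simpleG : simple_graph G.

Lemma joins_ball_edges x r u v e : joins G u v e ->
  ball_vertices G x r u -> ball_vertices G x r v -> ball_edges G x r e.
Proof.
move=> uve ux vx y; rewrite (joins_endpoint simpleG _ uve).
by move=> /orP[]/eqP->.
Qed.

Lemma trace_ball_edges x0 r x s e :
  {in x :: s, forall v, ball_vertices G x0 r v} -> trace G x s e ->
  ball_edges G x0 r e.
Proof.
by move=> H /trace_mem[u [v [/H us /H vs uve]]]; apply: (joins_ball_edges uve).
Qed.

Lemma edge_walk_edges x0 r x s es :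
  {in x :: s, forall v, ball_vertices G x0 r v} ->
  edge_walk G x s es -> {in es, forall a, ball_edges G x0 r a}.
Proof.
elim: s x es => [|b s IH] a [|c es] //= Hw /andP[abc ws] e.
rewrite inE => /orP[/eqP->|]; last first.
  by apply: (IH b) ws _ => w ws'; apply: Hw; rewrite inE ws' orbT.
apply: (joins_ball_edges abc); apply: Hw; first exact: mem_head.
by rewrite !inE eqxx orbT.
Qed.

Lemma edge_walk_ball x0 t r x s es : (r + size s <= t)%N ->
  ball_vertices G x0 r x -> edge_walk G x s es ->
  {in x :: s, forall v, ball_vertices G x0 t v}.
Proof.
elim: s x r es => [|v s IH] x r [|a es] //= rt xr.
  move=> _ v; rewrite inE => /eqP->; apply: ball_vertices_le xr.
  by rewrite addn0 in rt.
move=> /andP[xva ws] b; rewrite inE => /orP[/eqP->|].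
  by apply: ball_vertices_le xr; apply: leq_trans rt; exact: leq_addr.
apply: (IH v r.+1 es _ _ ws); first by rewrite addSnnS.
by apply: ball_vertices_step xr _; apply/adjP; exists a.
Qed.

Section LocallyFinite.
Variable m : nat.
Hypothesis regG : regular_tiling G m.

Lemma finite_edges_at x : finite_set [set e | endpoint G x e].
Proof. by exists m; exact: regG. Qed.

Lemma finite_walks n x :
  finite_set [set z : seq V * seq E | size z.1 = n /\ edge_walk G x z.1 z.2].
Proof.
elim: n x => [|n IH] x.
  apply: (@sub_finite_set _ _ [set ([::], [::])]) => //.
  by move=> [s es] /= [/size0nil-> ]; case: es.
pose D := [set q : V * E | joins G x q.1 q.2].
have finD : finite_set D.
  pose D' := \bigcup_(e in [set e | endpoint G x e])
    ((fun v => (v, e)) @` [set v | endpoint G v e]).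
  apply: (@sub_finite_set _ _ D').
    move=> [v e] /= /and3P[xv xe ve]; exists e => //=; by exists v.
  apply: bigcup_finite => [|e _]; first exact: finite_edges_at.
  apply: finite_image; have [u [v [uv H]]] := simpleG.1 e.
  apply: (@sub_finite_set _ _ [set u; v]) => // w /=.
  by rewrite H => /orP[]/eqP; [left|right].
pose W := \bigcup_(q in D) ((fun z : seq V * seq E => (q.1 :: z.1, q.2 :: z.2)) @`
  [set z : seq V * seq E | size z.1 = n /\ edge_walk G q.1 z.1 z.2]).
apply: (@sub_finite_set _ _ W).
  move=> [[|v s] [|e es]] //= [] // [sn].
  move=> /andP[xve ves]; exists (v, e) => //=; exists (s, es) => //=.
by apply: bigcup_finite => // q _; apply: finite_image; exact: IH.
Qed.

Lemma finite_ball_vertices x n : finite_set (ball_vertices G x n).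
Proof.
pose W := \bigcup_(k in `I_n.+1) ((fun z : seq V * seq E => last x z.1) @`
  [set z : seq V * seq E | size z.1 = k /\ edge_walk G x z.1 z.2]).
apply: (@sub_finite_set _ _ W).
  move=> y [s [/path_edge_walk[es ws _] ls ss]]; exists (size s) => //=.
  by exists (s, es).
apply: bigcup_finite => [|k _]; first exact: finite_II.
by apply: finite_image; exact: finite_walks.
Qed.

Lemma finite_ball_edges x n : finite_set (ball_edges G x n).
Proof.
apply: (@sub_finite_set _ _
  (\bigcup_(y in ball_vertices G x n) [set e | endpoint G y e])).
  move=> e He; have [u [v [uv H]]] := simpleG.1 e.
  by exists u => /=; [apply: He|]; rewrite H eqxx.
apply: bigcup_finite => [|y _]; first exact: finite_ball_vertices.
exact: finite_edges_at.
Qed.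

End LocallyFinite.
End Balls.

(** Makes the filling radius below independent of the closed walk. *)
Lemma finite_uniform_bound (I : finType) (Q : I -> nat -> Prop) :
  (forall i r r', (r <= r')%N -> Q i r -> Q i r') -> (forall i, exists r, Q i r) ->
  exists r, forall i, Q i r.
Proof.
move=> mQ /choice[g Hg]; exists (\max_(i in I) g i)%N => i.
exact: mQ (leq_bigmax _) (Hg i).
Qed.

Section Filling.
Variables (V E F : choiceType) (G : tiling V E F) (m : nat).
Hypothesis hypG : hyperbolic_tiling m G.

Let surfG : surface_tiling G. Proof. by case: hypG => -[]. Qed.
Let simpleG : simple_graph G. Proof. by case: surfG. Qed.
Let regG : regular_tiling G m. Proof. by case: hypG. Qed.

Lemma seq_in_ball x0 (s : seq V) :
  exists r, {in s, forall v, ball_vertices G x0 r v}.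
Proof.
elim: s => [|v s [r Hr]]; first by exists 0%N.
have [t pt lt] : exists2 t, path.path (adj G) x0 t & last x0 t = v.
  by case: surfG => _ _ + _ _; exact.
exists (maxn r (size t)) => u; rewrite inE => /orP[/eqP->|/Hr].
  exists t; split=> //; exact: leq_maxr.
by apply: ball_vertices_le; exact: leq_maxl.
Qed.

Lemma face_in_ball x0 f : exists r, ball_faces G x0 r f.
Proof.
have [c fc] : exists c, boundary_cycle G f c by case: surfG => _ _ _ + _; exact.
have [r Hr] := seq_in_ball x0 c; exists r => e fe.
case: fc => sc Uc Cc /(_ e fe)[u uc /andP[ue nue]].
have [e' fe' ue'] : exists2 e', side G f e' & joins G u (path.next c u) e'.
  exact/adj_inP/(next_cycle Cc).
apply: (@joins_ball_edges _ _ _ G simpleG x0 r u (path.next c u)).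
- by rewrite /joins ue nue; case/andP: ue' => ->.
- exact: Hr.
- by apply: Hr; rewrite mem_next.
Qed.

Lemma faces_in_ball x0 (fs : seq F) :
  exists r, {in fs, forall f, ball_faces G x0 r f}.
Proof.
elim: fs => [|f fs [r Hr]]; first by exists 0%N.
have [r' Hr'] := face_in_ball x0 f.
exists (maxn r r') => g; rewrite inE => /orP[/eqP->|/Hr].
  by apply: ball_faces_le Hr'; exact: leq_maxr.
by apply: ball_faces_le; exact: leq_maxl.
Qed.

Lemma closed_walk_filling x s : path.path (adj G) x s -> last x s = x ->
  exists fs, trace G x s =1 face_parity G fs.
Proof.
move=> ps ls; have simp : simply_connected_tiling G by case: hypG => -[].
have [fs H] := homotopic_chain simpleG (simp x s ps ls).
by exists fs => e; rewrite [LHS]H.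
Qed.

(** Closed walks of a ball are infinitely many, but their chains are subsets of
    the finitely many edges of the ball; the radius needed to fill a walk depends
    only on its chain. *)
Lemma ball_filling x0 n : exists T, forall x s,
  path.path (adj G) x s -> last x s = x ->
  {in x :: s, forall v, ball_vertices G x0 n v} ->
  exists2 fs, {in fs, forall f, ball_faces G x0 T f} &
    trace G x s =1 face_parity G fs.
Proof.
have /finite_seqP[B BE] := finite_ball_edges simpleG regG x0 n.
pose code x s := map_tuple (trace G x s) (in_tuple B).
pose Q (tau : (size B).-tuple bool) T := forall x s,
  path.path (adj G) x s -> last x s = x ->
  {in x :: s, forall v, ball_vertices G x0 n v} -> code x s = tau ->
  exists2 fs, {in fs, forall f, ball_faces G x0 T f} &
    trace G x s =1 face_parity G fs.
have [T HT] : exists T, forall tau, Q tau T.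
  apply: finite_uniform_bound.
    move=> tau r r' rr' H x s ps ls xs cs; have [fs Hfs tfs] := H x s ps ls xs cs.
    by exists fs => // f /Hfs; exact: ball_faces_le.
  move=> tau; have [[x [s [ps ls xs cs]]]|no] := pselect (exists x s,
    [/\ path.path (adj G) x s, last x s = x,
      {in x :: s, forall v, ball_vertices G x0 n v} & code x s = tau]); last first.
    by exists 0%N => x s ps ls xs cs; exfalso; apply: no; exists x, s.
  have [fs tfs] := closed_walk_filling ps ls.
  have [r Hr] := faces_in_ball x0 fs.
  exists r => x' s' ps' ls' xs' cs'; exists fs => // e.
  rewrite -tfs; case: (boolP (e \in B)) => [eB|eNB].
    move: cs'; rewrite -cs => /(congr1 val) /= /eq_in_map; exact.
  have out y t : {in y :: t, forall v, ball_vertices G x0 n v} ->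
      trace G y t e = false.
    move=> H; apply/negP => /(trace_ball_edges simpleG H).
    by rewrite BE /= (negbTE eNB).
  by rewrite !out.
by exists T => x s ps ls xs; exact: (HT (code x s)).
Qed.

Lemma infinite_balls x0 N : exists T, exists2 s : seq V, uniq s /\ size s = N &
  {in s, forall v, ball_vertices G x0 T v}.
Proof.
have infV : infinite_set [set: V] by case: hypG => -[].
have [A _ cA] := infinite_set_fset N infV.
have [r Hr] := seq_in_ball x0 (take N (finmap.enum_fset A)).
exists r; exists (take N (finmap.enum_fset A)) => //.
split; first exact/take_uniq/finmap.fset_uniq.
by rewrite size_take_min; apply/minn_idPl.
Qed.

End Filling.

(** * Ball isomorphisms with prescribed centre *)

Lemma set_bijP (T U : Type) (A : set T) (B : set U) (f : T -> U) :
  set_bij A B f <->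
  [/\ forall x, A x -> B (f x), forall x y, A x -> A y -> f x = f y -> x = y
    & forall y, B y -> exists2 x, A x & f x = y].
Proof.
split=> [[fAB finj fsurj]|[fAB finj fsurj]].
  by split=> [|x y Ax Ay|]; [exact: fAB|apply: finj; exact: mem_set|exact: fsurj].
by split=> // x y /set_mem Ax /set_mem Ay; exact: finj.
Qed.

Lemma regular_edges (V E F : choiceType) (G : tiling V E F) m x :
  regular_tiling G m ->
  exists s, [/\ uniq s, size s = m & forall e, (e \in s) = endpoint G x e].
Proof.
move=> reg; have /finite_fsetP[X XE] : finite_set [set e | endpoint G x e].
  by exists m; exact: reg.
have := reg x; rewrite XE => /card_eq_fsetP sX.
exists (finmap.enum_fset X); split=> //.
move=> e; have := congr1 (fun A : set E => A e) XE => /= H.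
by apply/idP/idP => [eX|]; [rewrite H|rewrite H].
Qed.

Section PieceIso.
Variables (V E F V' E' F' : choiceType).
Variables (G' : tiling V' E' F') (G : tiling V E F).
Variables (A' : set V') (B' : set E') (C' : set F').
Variables (A : set V) (B : set E) (C : set F).
Variables (h : V' -> V) (k : E' -> E) (l : F' -> F).
Hypothesis iso : piece_isomorphism G' G A' B' C' A B C h k l.

Lemma piece_joins u v e : A' u -> A' v -> B' e ->
  joins G (h u) (h v) (k e) = joins G' u v e.
Proof.
case: iso => /set_bijP[_ hinj _] _ _ He _ Au Av Be.
rewrite /joins !He //; case: (eqVneq u v) => [->|uv]; first by rewrite eqxx.
by case: eqP => // /(hinj _ _ Au Av) uvE; rewrite uvE eqxx in uv.
Qed.

Lemma piece_edge_walk x s es : {in x :: s, forall v, A' v} ->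
  {in es, forall e, B' e} ->
  edge_walk G (h x) (map h s) (map k es) = edge_walk G' x s es.
Proof.
elim: s x es => [|v s IH] x [|e es] //= Hs Hes.
rewrite piece_joins ?IH //.
- by move=> w ws; apply: Hs; rewrite inE ws orbT.
- by move=> w ws; apply: Hes; rewrite inE ws orbT.
- by apply: Hs; rewrite mem_head.
- by apply: Hs; rewrite !inE eqxx orbT.
- by apply: Hes; rewrite mem_head.
Qed.

Lemma piece_trace x s e : {in x :: s, forall v, A' v} -> B' e ->
  trace G (h x) (map h s) (k e) = trace G' x s e.
Proof.
move=> + Be; elim: s x => [|v s IH] x //= Hs.
rewrite piece_joins ?IH //.
- by move=> w ws; apply: Hs; rewrite inE ws orbT.
- by apply: Hs; rewrite mem_head.
- by apply: Hs; rewrite !inE eqxx orbT.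
Qed.

End PieceIso.

Lemma piece_isomorphism_comp (V E F V' E' F' V'' E'' F'' : choiceType)
  (G : tiling V E F) (G' : tiling V' E' F') (G'' : tiling V'' E'' F'')
  A B C A' B' C' A'' B'' C'' h k l h' k' l' :
  piece_isomorphism G G' A B C A' B' C' h k l ->
  piece_isomorphism G' G'' A' B' C' A'' B'' C'' h' k' l' ->
  piece_isomorphism G G'' A B C A'' B'' C'' (h' \o h) (k' \o k) (l' \o l).
Proof.
move=> [bh bk bl ev sf] [bh' bk' bl' ev' sf'].
move: (bh) (bk) (bl) => /set_bijP[hA _ _] /set_bijP[kB _ _] /set_bijP[lC _ _].
have comp T T' T'' (X : set T) (X' : set T') (X'' : set T'') f f' :
    set_bij X X' f -> set_bij X' X'' f' -> set_bij X X'' (f' \o f).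
  move=> /set_bijP[f1 f2 f3] /set_bijP[g1 g2 g3]; apply/set_bijP; split => /=.
  - by move=> x /f1/g1.
  - by move=> x y Xx Xy /g2 H; apply: f2 => //; apply: H; exact: f1.
  - by move=> z /g3[y /f3[x Xx <-] <-]; exists x.
split; [exact: comp bh bh'|exact: comp bk bk'|exact: comp bl bl'| |].
- by move=> x e Ax Be /=; rewrite ev' ?ev //; [exact: hA|exact: kB].
- by move=> f e Ax Be /=; rewrite sf' ?sf //; [exact: lC|exact: kB].
Qed.

Section Isom.
Variables (V E F V' E' F' : choiceType).
Variables (G : tiling V E F) (G' : tiling V' E' F').
Variables (h : V -> V') (k : E -> E') (l : F -> F').
Hypothesis iso : isomorphism G G' h k l.

Lemma isomorphism_adj u v : adj G' (h u) (h v) = adj G u v.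
Proof.
apply/adjP/adjP => -[e uve]; last by exists (k e); rewrite (piece_joins iso).
case: (iso) => _ /set_bijP[_ _ /(_ e I)[e' _ e'E]] _ _ _.
by exists e'; rewrite -(piece_joins iso) // e'E.
Qed.

Lemma isomorphism_ball_vertices x r v :
  ball_vertices G' (h x) r (h v) <-> ball_vertices G x r v.
Proof.
case: (iso) => /set_bijP[_ hinj hsurj] _ _ _ _.
elim: r v => [|r IH] v.
  split=> -[[|w s] [_ /= ls ss]] //; exists [::]; split=> //=; last by rewrite ls.
  exact: hinj.
split=> /ball_verticesS [H|[w wb wv]].
- by apply: ball_vertices_le (leqnSn r) _ _; apply/IH.
- have [y _ yE] := hsurj w I; rewrite -yE in wb wv.
  apply: (@ball_vertices_step _ _ _ G x r y); first exact/IH.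
  by rewrite -isomorphism_adj.
- by apply: ball_vertices_le (leqnSn r) _ _; apply/IH.
- apply: (@ball_vertices_step _ _ _ G' (h x) r (h w)); first exact/IH.
  by rewrite isomorphism_adj.
Qed.

Lemma isomorphism_balls x r : piece_isomorphism G G'
  (ball_vertices G x r) (ball_edges G x r) (ball_faces G x r)
  (ball_vertices G' (h x) r) (ball_edges G' (h x) r) (ball_faces G' (h x) r)
  h k l.
Proof.
have bv := isomorphism_ball_vertices x r.
case: (iso) => /set_bijP[_ hinj hsurj] /set_bijP[_ kinj ksurj].
move=> /set_bijP[_ linj lsurj] ev sf.
have be e : ball_edges G' (h x) r (k e) <-> ball_edges G x r e.
  split=> H y.
    by move=> ye; apply/bv/H; rewrite ev.
  by have [v _ <-] := hsurj y I; rewrite ev // => /H /bv.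
have bf f : ball_faces G' (h x) r (l f) <-> ball_faces G x r f.
  split=> H e.
    by move=> fe; apply/be/H; rewrite sf.
  by have [e' _ <-] := ksurj e I; rewrite sf // => /H /be.
split; [apply/set_bijP; split|apply/set_bijP; split|apply/set_bijP; split| |].
- by move=> v /bv.
- by move=> u v _ _; exact: hinj.
- by move=> v; have [u _ <-] := hsurj v I => /bv; exists u.
- by move=> v /be.
- by move=> u v _ _; exact: kinj.
- by move=> v; have [u _ <-] := ksurj v I => /be; exists u.
- by move=> v /bf.
- by move=> u v _ _; exact: linj.
- by move=> v; have [u _ <-] := lsurj v I => /bf; exists u.
- by move=> v e _ _; exact: ev.
- by move=> v e _ _; exact: sf.
Qed.

End Isom.

Section Centering.
Variables (V E F V' E' F' : choiceType).
Variables (G : tiling V E F) (G' : tiling V' E' F') (m : nat).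
Hypothesis simpleG : simple_graph G.
Hypotheses (regG : regular_tiling G m) (regG' : regular_tiling G' m).
Variables (y : V') (x0 : V) (t : nat).
Local Notation A' := (ball_vertices G' y t).
Local Notation B' := (ball_edges G' y t).
Variables (h : V' -> V) (k : E' -> E) (l : F' -> F).
Hypothesis iso : piece_isomorphism G' G A' B' (ball_faces G' y t)
  (ball_vertices G x0 t) (ball_edges G x0 t) (ball_faces G x0 t) h k l.

Lemma interior_joins_edges r u v e : (r < t)%N -> ball_vertices G x0 r u ->
  joins G u v e -> ball_edges G x0 t e.
Proof.
move=> rt xu uve; apply: (joins_ball_edges simpleG uve).
  by apply: ball_vertices_le xu; exact: ltnW.
apply: (ball_vertices_le rt); apply: ball_vertices_step xu _.
by apply/adjP; exists e.
Qed.

(** An interior vertex of the ball of [G] has its [m] edges in this ball. They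
    come from [m] edges at the corresponding vertex of [G'], which has no others.
    *)
Lemma interior_edges z r e' : (r < t)%N -> A' z -> ball_vertices G x0 r (h z) ->
  endpoint G' z e' -> B' e'.
Proof.
move=> rt Az xz ze'.
have [s [Us ss sE]] := regular_edges (h z) regG.
have [s' [Us' ss' s'E]] := regular_edges z regG'.
case: (iso) => _ /set_bijP[kB kinj ksurj] _ ev _.
have /choice[g Hg] : forall e, exists e'', e \in s -> B' e'' /\ k e'' = e.
  move=> e; case: (boolP (e \in s)) => [|_]; last by exists e'.
  rewrite sE => ze.
  have [|e'' Be'' e''E] := ksurj e; last by exists e''.
  have [v zve] : exists v, joins G (h z) v e.
    have [u [v uve]] := edge_joins simpleG e.
    move: ze; rewrite (joins_endpoint simpleG _ uve) => /orP[]/eqP ->.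
      by exists v.
    by exists u; rewrite joinsC.
  exact: (interior_joins_edges rt xz zve).
(* The edges [map g s] are [m] distinct edges at [z], hence all of them. *)
have Ug : uniq (map g s).
  rewrite map_inj_in_uniq // => a b /Hg[_ ka] /Hg[_ kb] gab.
  by rewrite -ka -kb gab.
have sub : {subset map g s <= s'}.
  move=> _ /mapP[e es ->]; have [Be ke] := Hg e es.
  by rewrite s'E -ev // ke -sE.
have [|_ eqs] := uniq_min_size Ug sub; first by rewrite size_map ss ss'.
have : e' \in map g s by rewrite eqs s'E.
by case/mapP => e /Hg[Bg _] ->.
Qed.

Variable y' : V'.
Hypotheses (Ay' : A' y') (hy' : h y' = x0).

Lemma centered_ball_push r z : (r <= t)%N -> ball_vertices G' y' r z ->
  A' z /\ ball_vertices G x0 r (h z).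
Proof.
elim: r z => [|r IH] z rt.
  move=> [[|w s] [_ /= <- ss]] //; split => //; rewrite hy'.
  exact: ball_vertices_center.
move=> /ball_verticesS[/(IH _ (ltnW rt))[Az xz]|[w /(IH _ (ltnW rt))[Aw xw]]].
  by split=> //; apply: ball_vertices_le xz.
move=> /adjP[e' wz].
have Be' : B' e'.
  by apply: (interior_edges rt Aw xw); case/and3P: wz.
have Az : A' z by apply: Be'; case/and3P: wz.
split=> //; apply: ball_vertices_step xw _.
by apply/adjP; exists (k e'); rewrite (piece_joins iso).
Qed.

Lemma centered_ball_pull r z : (r <= t)%N -> A' z ->
  ball_vertices G x0 r (h z) -> ball_vertices G' y' r z.
Proof.
case: (iso) => /set_bijP[hA hinj hsurj] /set_bijP[kB kinj ksurj] _ ev _.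
elim: r z => [|r IH] z rt Az.
  move=> [[|w s] [_ /= hz ss]] //; exists [::]; split=> //=; apply: hinj => //.
  by rewrite hy'.
move=> /ball_verticesS[/(IH _ (ltnW rt) Az)|[w xw /adjP[e we]]].
  by apply: ball_vertices_le.
have [|u Au uw] := hsurj w; first by apply: ball_vertices_le xw; exact: ltnW.
have [e' Be' e'E] := ksurj e (interior_joins_edges rt xw we).
rewrite -uw in xw; have yu := IH u (ltnW rt) Au xw.
apply: ball_vertices_step yu _; apply/adjP; exists e'.
by rewrite -(piece_joins iso) // e'E uw.
Qed.

Lemma centered_ball : ball_vertices G' y' t = A'.
Proof.
apply/seteqP; split=> z; first by move/(centered_ball_push (leqnn t)) => [].
move=> Az; apply: centered_ball_pull => //.
by case: iso => /set_bijP[hA _ _] _ _ _ _; exact: hA.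
Qed.

(** An isomorphism of balls need not send centre to centre, but [y'], the
    preimage of [x0], is then another centre of the same ball of [G']. *)
Lemma centered_iso : piece_isomorphism G' G
  (ball_vertices G' y' t) (ball_edges G' y' t) (ball_faces G' y' t)
  (ball_vertices G x0 t) (ball_edges G x0 t) (ball_faces G x0 t) h k l.
Proof.
rewrite centered_ball.
have -> : ball_edges G' y' t = B' by rewrite /ball_edges centered_ball.
have -> // : ball_faces G' y' t = ball_faces G' y t.
by rewrite /ball_faces /ball_edges centered_ball.
Qed.

End Centering.

(** Edge-transitivity moves the isomorphism centred at [y'] to any edge [e'] of
    [G']: it is a chart of [G'] near [e']. *)
Lemma rooted_ball_isomorphism (V E F V' E' F' : choiceType)
  (G : tiling V E F) (G' : tiling V' E' F') (m t : nat) x0 e y e' :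
  simple_graph G ->
  regular_tiling G m -> regular_tiling G' m -> edge_transitive G' ->
  (0 < t)%N -> isomorphic_balls G' G t y x0 -> endpoint G x0 e ->
  exists z h k l, [/\ endpoint G' z e', piece_isomorphism G' G
  (ball_vertices G' z t) (ball_edges G' z t) (ball_faces G' z t)
  (ball_vertices G x0 t) (ball_edges G x0 t) (ball_faces G x0 t) h k l,
  h z = x0 & k e' = e].
Proof.
move=> simpG regG regG' etrans t0 [h [k [l iso]]] x0e.
have [y' Ay' hy'] : exists2 y', ball_vertices G' y t y' & h y' = x0.
  case: iso => /set_bijP[_ _ + ] _ _ _ _; apply; exact: ball_vertices_center.
have ciso := centered_iso simpG regG regG' iso Ay' hy'.
have [u [v uve]] := edge_joins simpG e.
have [w x0we] : exists w, joins G x0 w e.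
  move: x0e; rewrite (joins_endpoint simpG _ uve) => /orP[]/eqP ->.
    by exists v.
  by exists u; rewrite joinsC.
have Be : ball_edges G x0 t e.
  by apply: (interior_joins_edges simpG t0 _ x0we); exact: ball_vertices_center.
have [e'' Be'' e''E] : exists2 e'', ball_edges G' y' t e'' & k e'' = e.
  by case: ciso => _ /set_bijP[_ _ + ] _ _ _; exact.
have y'e'' : endpoint G' y' e''.
  case: ciso => _ _ _ <- //; last exact: ball_vertices_center.
  by rewrite hy' e''E.
have [phi [psi [chi [aut autE]]]] := etrans e' e''.
have [z _ zE] : exists2 z, setT z & phi z = y'.
  by case: aut => /set_bijP[_ _ + ] _ _ _ _; exact.
exists z, (h \o phi), (k \o psi), (l \o chi); split => /=.
- by case: aut => _ _ _ <- // _; rewrite zE autE.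
- apply: piece_isomorphism_comp (isomorphism_balls aut z t) _.
  by rewrite zE.
- by rewrite zE.
- by rewrite autE.
Qed.

(** * Ranks of incidence matrices and the homology defect *)

Lemma addF2 (x : 'F_2) : x + x = 0.
Proof. by case: x => [[|[|//]]] ?; apply/val_inj. Qed.

Lemma addF2_eq0 (x y : 'F_2) : x + y = 0 -> x = y.
Proof. by move=> xy; rewrite -[x]addr0 -(addF2 y) addrA xy add0r. Qed.

Definition bit (b : bool) : 'F_2 := b%:R.

Lemma bitD b1 b2 : bit (b1 (+) b2) = bit b1 + bit b2.
Proof. by case: b1; case: b2; apply/val_inj. Qed.

Lemma sum_endpoint (V E F : finType) (G : tiling V E F) u v e (z : V -> 'F_2) :
  simple_graph G -> joins G u v e ->
  \sum_w z w * bit (endpoint G w e) = z u + z v.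
Proof.
move=> simpleG uve; have uv : u != v by case/andP: uve.
rewrite (bigD1 u) //= (bigD1 v) /=; last by rewrite eq_sym.
rewrite !(joins_endpoint simpleG _ uve) !eqxx orbT !mulr1 big1 ?addr0 //.
move=> w /andP[wu wv]; rewrite (joins_endpoint simpleG _ uve).
by rewrite (negbTE wu) (negbTE wv) mulr0.
Qed.

Section RankBounds.
Variables (V E F : finType) (G : tiling V E F).
Hypotheses (simpleG : simple_graph G) (simpleD : simple_graph (dual G)).

Definition boundary (c : E -> 'F_2) (v : V) : 'F_2 :=
  \sum_e c e * bit (endpoint G v e).

Definition face_sum (y : F -> 'F_2) (e : E) : 'F_2 :=
  \sum_f y f * bit (side G f e).

Lemma boundary_joins u v w : adj G u v ->
  boundary (fun e => bit (joins G u v e)) w = bit (u == w) + bit (v == w).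
Proof.
case/adj_inP => e _ uve; rewrite /boundary (bigD1 e) //= uve mul1r.
rewrite big1 ?addr0 => [|e' ee']; last first.
  case uve' : (joins G u v e'); last by rewrite mul0r.
  by rewrite (joins_uniq simpleG uve uve') eqxx in ee'.
rewrite (joins_endpoint simpleG w uve) !(eq_sym w).
case: eqVneq => [uw|_]; last by rewrite add0r.
case: eqVneq => [vw|_]; last by rewrite addr0.
by case/andP: uve; rewrite uw vw eqxx.
Qed.

Lemma boundary_trace x s w : path.path (adj G) x s ->
  boundary (fun e => bit (trace G x s e)) w = bit (x == w) + bit (last x s == w).
Proof.
elim: s x => [|v s IH] x /=.
  by move=> _; rewrite addF2 /boundary big1 // => e _; rewrite mul0r.
move=> /andP[xv /IH ps]; rewrite -[bit (x == w)]addr0 -(addF2 (bit (v == w))).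
rewrite (addrA (bit (x == w))) -(addrA (_ + _)) -ps -boundary_joins // /boundary -big_split /=.
by apply: eq_bigr => e _; rewrite bitD mulrDl.
Qed.

Lemma boundary_side f w : (exists c, boundary_cycle G f c) ->
  boundary (fun e => bit (side G f e)) w = 0.
Proof.
move=> [[|u c] fc]; first by case: fc.
have pc : path.path (adj G) u (rcons c u).
  by case: fc => _ _ /(path_adj_in_sub (@subsetT _ _)).
transitivity (boundary (fun e => bit (trace G u (rcons c u) e)) w).
  apply: eq_bigr => e _; congr (bit _ * _).
  by rewrite -(boundary_cycle_chain simpleG e fc).
by rewrite boundary_trace // last_rcons addF2.
Qed.

Lemma dual_constant (y : F -> 'F_2) :
  (forall f g, adj (dual G) f g -> y f = y g) ->
  connected_tiling (dual G) -> forall f g, y f = y g.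
Proof.
move=> H conn f g; have [s ps <-] := conn f g.
elim: s f ps => [|f' s IH] f //= /andP[/H-> /IH]; exact.
Qed.

(** The incidence matrices are indexed by the elements of [S] and of its
    complement separately. *)
Lemma sum_split_set (S : {set E}) (z : E -> 'F_2) :
  \sum_e z e = \sum_(i < #|S|) z (enum_val i) + \sum_(i < #|~: S|) z (enum_val i).
Proof.
rewrite (bigID (mem S)) /= -big_enum_val; congr (_ + _).
by rewrite -big_enum_val; apply: eq_bigl => e; rewrite inE.
Qed.

Variable S : {set E}.

Let X : 'M['F_2]_(#|V|, #|S|) :=
  \matrix_(i, j) (endpoint G (enum_val i) (enum_val j))%:R.
Let N : 'M['F_2]_(#|F|, #|~: S|) :=
  \matrix_(i, j) (side G (enum_val i) (enum_val j))%:R.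
Let Y : 'M['F_2]_(#|F|, #|S|) :=
  \matrix_(i, j) (side G (enum_val i) (enum_val j))%:R.

Let rankX : \rank X = graph_rank G S. Proof. by []. Qed.
Let rankN : \rank N = graph_rank (dual G) (~: S). Proof. by []. Qed.

Lemma rank_kerX : (\rank (kermx X^T) = #|S| - graph_rank G S)%N.
Proof. by rewrite mxrank_ker mxrank_tr. Qed.

Lemma rank_kerN : (\rank (kermx N) = #|F| - graph_rank (dual G) (~: S))%N.
Proof. by rewrite mxrank_ker. Qed.

Lemma graph_rank_le : (graph_rank G S <= #|S|)%N.
Proof. by rewrite -rankX rank_leq_col. Qed.

Lemma dual_rank_le : (graph_rank (dual G) (~: S) <= #|F|)%N.
Proof. by rewrite -rankN rank_leq_row. Qed.

Lemma mul_incidence (u : 'rV_#|S|) (c : E -> 'F_2) v :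
  (forall j, u 0 j = c (enum_val j)) -> (forall e, e \notin S -> c e = 0) ->
  (u *m X^T) 0 (enum_rank v) = boundary c v.
Proof.
move=> uc cS; rewrite /boundary (sum_split_set S) [X in _ + X]big1 ?addr0 => [|j _].
  by rewrite mxE; apply: eq_bigr => j _; rewrite !mxE uc enum_rankK.
by have := enum_valP j; rewrite inE => /cS->; rewrite mul0r.
Qed.

Lemma mul_faces (T : {set E}) (u : 'rV_#|F|) j :
  (u *m (\matrix_(i < #|F|, j < #|T|) (side G (enum_val i) (enum_val j))%:R)) 0 j
  = face_sum (fun f => u 0 (enum_rank f)) (enum_val j).
Proof.
rewrite mxE /face_sum [RHS](reindex_onto enum_val enum_rank) /=; last first.
  by move=> f _; rewrite enum_rankK.
rewrite [RHS](eq_bigl xpredT); last by move=> i; rewrite enum_valK eqxx.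
by apply: eq_bigr => i _; rewrite mxE enum_valK.
Qed.

(** The kernel of [N] consists of the sets of faces whose boundary lies in [S];
    [Y] computes this boundary, which is a cycle of [S]. Two sets of faces with
    the same boundary are equal or complementary, as the dual graph is connected,
    so at most one dimension is lost. *)
Lemma rank_gap_lower : (forall f, exists c, boundary_cycle G f c) ->
  connected_tiling (dual G) ->
  (#|F| + graph_rank G S <= #|S| + graph_rank (dual G) (~: S) + 1)%N.
Proof.
move=> cyc conn.
have le1 : (\rank (kermx N *m Y) <= \rank (kermx X^T))%N.
  apply: mxrankS; apply/rV_subP => u /submxP[w uE].
  pose c := face_sum (fun f => (w *m kermx N) 0 (enum_rank f)).
  have uc j : u 0 j = c (enum_val j) by rewrite uE mulmxA mul_faces.
  apply/sub_kermxP/rowP => i; rewrite [RHS]mxE -[i]enum_valK.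
  rewrite (mul_incidence _ uc) => [|e eS]; last first.
    have eS' : e \in ~: S by rewrite inE.
    have := mul_faces (w *m kermx N) (enum_rank_in eS' e).
    rewrite -mulmxA mulmx_ker mulmx0 mxE enum_rankK_in //.
  (* Every face has an even number of edges at each vertex. *)
  transitivity (\sum_f (w *m kermx N) 0 (enum_rank f) *
     boundary (fun e => bit (side G f e)) (enum_val i)).
    rewrite /boundary /c /face_sum.
    under eq_bigr do rewrite mulr_suml.
    rewrite exchange_big; apply: eq_bigr => f _; rewrite mulr_sumr.
    by apply: eq_bigr => e _; rewrite mulrA.
  by rewrite big1 // => f _; rewrite boundary_side // mulr0.
(* A set of faces with no boundary is constant across every edge. *)
have le2 : (\rank (kermx N :&: kermx Y)%MS <= 1)%N.
  have sub : (kermx N :&: kermx Y <= (const_mx 1 : 'rV['F_2]_#|F|))%MS.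
    apply/rV_subP => u; rewrite sub_capmx => /andP[/sub_kermxP uN /sub_kermxP uY].
    pose y f := u 0 (enum_rank f).
    have y0 e : face_sum y e = 0.
      case: (boolP (e \in S)) => eS.
        by have := mul_faces u (enum_rank_in eS e); rewrite uY mxE enum_rankK_in.
      have eS' : e \in ~: S by rewrite inE.
      by have := mul_faces u (enum_rank_in eS' e); rewrite uN mxE enum_rankK_in.
    have yc : forall f g, y f = y g.
      apply: dual_constant conn => f g /adj_inP[e _ fge]; apply: addF2_eq0.
      have fgE := sum_endpoint y simpleD fge; rewrite -fgE; exact: y0.
    apply/submxP; case: (pickP (@predT F)) => [f _|F0]; last first.
      by exists 0; apply/rowP => i; have := F0 (enum_val i).
    exists (y f)%:M; apply/rowP => i.
    by rewrite mul_scalar_mx !mxE mulr1 (yc f (enum_val i)) /y enum_valK.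
  by apply: leq_trans (mxrankS sub) _; exact: rank_leq_row.
have := mxrank_mul_ker (kermx N) Y.
move: le1 le2; rewrite rank_kerX rank_kerN.
have := graph_rank_le; have := dual_rank_le; lia.
Qed.

(** Asking a cycle of [S] to vanish on [B] costs at most [#|B|] dimensions, and
    the cycles which remain are boundaries of sets of faces in the kernel of [N].
    *)
Lemma rank_gap_upper (B : {set E}) :
  (forall c : E -> 'F_2, (forall e, c e != 0 -> (e \in S) && (e \notin B)) ->
    (forall v, boundary c v = 0) -> exists y, face_sum y =1 c) ->
  (#|S| + graph_rank (dual G) (~: S) <= #|F| + graph_rank G S + #|B|)%N.
Proof.
move=> fill.
pose D : 'M['F_2]_(#|S|, #|B|) :=
  \matrix_(i, j) bit (enum_val i == enum_val j).
have le1 : (\rank (kermx X^T :&: kermx D)%MS <= \rank (kermx N))%N.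
  suff sub : (kermx X^T :&: kermx D <= kermx N *m Y)%MS.
    by apply: leq_trans (mxrankS sub) _; exact: mxrankM_maxl.
  apply/rV_subP => u; rewrite sub_capmx => /andP[/sub_kermxP uX /sub_kermxP uD].
  pose c e := \sum_(j < #|S|) u 0 j * bit (enum_val j == e).
  have uc j : u 0 j = c (enum_val j).
    rewrite /c (bigD1 j) //= eqxx mulr1 big1 ?addr0 // => i ij.
    by rewrite (inj_eq enum_val_inj) (negbTE ij) mulr0.
  have cS e : e \notin S -> c e = 0.
    move=> eS; rewrite /c big1 // => j _; case: eqP => [je|_]; last by rewrite mulr0.
    by have := enum_valP j; rewrite je (negbTE eS).
  have cB e : e \in B -> c e = 0.
    move=> eB; have := congr1 (fun M : 'rV_#|B| => M 0 (enum_rank_in eB e)) uD.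
    rewrite [RHS]mxE => <-; rewrite mxE; apply: eq_bigr => j _.
    by rewrite mxE enum_rankK_in.
  have [|v|y yc] := fill c.
  - move=> e; apply: contraNT; rewrite negb_and negbK.
    by case/orP => [/cS->|/cB->].
  - by rewrite -(mul_incidence v uc cS) uX mxE.
  pose w : 'rV['F_2]_#|F| := \row_i y (enum_val i).
  have wy (T : {set E}) (j : 'I_#|T|) : (w *m (\matrix_(i < #|F|, j < #|T|)
      (side G (enum_val i) (enum_val j))%:R)) 0 j = c (enum_val j).
    rewrite mul_faces -yc; apply: eq_bigr => f _.
    by rewrite mxE enum_rankK.
  have -> : u = w *m Y by apply/rowP => j; rewrite wy uc.
  apply: submxMr; apply/sub_kermxP/rowP => j; rewrite wy mxE cS //.
  by have := enum_valP j; rewrite inE.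
have := mxrank_mul_ker (kermx X^T) D.
have le2 := rank_leq_col (kermx X^T *m D).
move: le1 le2; rewrite rank_kerX rank_kerN.
have := graph_rank_le; have := dual_rank_le; lia.
Qed.

End RankBounds.

(** * Decomposition of cycles into closed walks *)

Section CycleFilling.
Variables (V E F : finType) (G : tiling V E F).
Hypothesis simpleG : simple_graph G.
Variable T : {set E}.
Hypothesis fillT : forall x s, path.path (adj_in G [set` T]) x s ->
  last x s = x -> exists y, forall e, face_sum G y e = bit (trace G x s e).

Local Notation r := (adj_in G [set` T]).

(** Let [w v] be a walk to [v] from a fixed root of its component. Replacing
    each edge [u v] of the cycle [c] by the closed walk [w u], [u v], reversed
    [w v] adds every [w v] as many times as [c] has edges at [v], an even number:
    so [c] is the sum of these closed walks. *)
Lemma cycle_filling (c : E -> 'F_2) : (forall e, c e != 0 -> e \in T) ->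
  (forall v, boundary G c v = 0) -> exists y, face_sum G y =1 c.
Proof.
move=> cT bc0.
have csym : connect_sym r by apply/sym_connect_sym/adj_in_sym.
pose root := fingraph.root r.
have /choice[w wP] : forall v, exists s, path.path r (root v) s /\ last (root v) s = v.
  move=> v; have /connectP[s ps ls] : connect r (root v) v.
    by rewrite csym connect_root.
  by exists s.
pose W v e := bit (trace G (root v) (w v) e).
have /choice[Y YP] : forall e, exists y : F -> 'F_2, e \in T -> forall e',
    face_sum G y e' = bit (e' == e) + \sum_v W v e' * bit (endpoint G v e).
  move=> e; case: (boolP (e \in T)) => [eT|_]; last by exists (fun=> 0).
  have [u [v uve]] := edge_joins simpleG e.
  have ruv : r u v by apply/adj_inP; exists e.
  have rootE : root u = root v.
    by apply/eqP; rewrite (fingraph.root_connect csym) // connect1.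
  have [pu lu] := wP u; have [pv lv] := wP v.
  have rv : path.path r v (rev (belast (root v) (w v))).
    rewrite -{1}lv rev_path; apply: sub_path pv => a b; by rewrite adj_in_sym.
  have lrv : last v (rev (belast (root v) (w v))) = root v.
    by case: (w v) lv => [|a s] //= _; rewrite rev_cons last_rcons.
  have [||y yP] := fillT (x := root u)
    (s := w u ++ v :: rev (belast (root v) (w v))).
  - by rewrite cat_path pu lu /= ruv.
  - by rewrite last_cat /= lrv.
  exists y => _ e'; rewrite yP (sum_endpoint _ simpleG uve) trace_cat lu /=.
  rewrite -{2}lv trace_rev !bitD addrCA; congr (bit _ + (_ + _)).
  apply/idP/eqP => [uve'|->//]; exact: joins_uniq uve' uve.
exists (fun f => \sum_e c e * Y e f) => e'.
transitivity (\sum_e c e * face_sum G (Y e) e').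
  rewrite /face_sum; under eq_bigr do rewrite mulr_suml.
  rewrite exchange_big; apply: eq_bigr => e _; rewrite mulr_sumr.
  by apply: eq_bigr => f _; rewrite mulrA.
transitivity (\sum_e (c e * bit (e' == e) +
    \sum_v W v e' * (c e * bit (endpoint G v e)))).
  apply: eq_bigr => e _; case: (eqVneq (c e) 0) => [->|/cT eT].
    by rewrite !mul0r big1 ?addr0 // => v _; rewrite mul0r mulr0.
  rewrite YP // mulrDr mulr_sumr; congr (_ + _).
  by apply: eq_bigr => v _; rewrite mulrCA.
rewrite big_split exchange_big /= [X in _ + X]big1 ?addr0 => [|v _]; last first.
  by rewrite -mulr_sumr [X in _ * X]bc0 mulr0.
rewrite (bigD1 e') //= eqxx mulr1 big1 ?addr0 // => e ee'.
by rewrite eq_sym (negbTE ee') mulr0.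
Qed.

End CycleFilling.

(** * Probability of a finite union of cylinders *)

Lemma size_undup_map_in (T T' : eqType) (k : T -> T') (s : seq T) :
  {in s &, injective k} -> size (undup (map k s)) = size (undup s).
Proof.
elim: s => [//|a s IH] kinj /=.
have {}IH : size (undup (map k s)) = size (undup s).
  by apply: IH => b c bs cs; apply: kinj; rewrite inE ?bs ?cs orbT.
have -> : (k a \in map k s) = (a \in s).
  apply/mapP/idP => [[b bs kab]|as_]; last by exists a.
  by rewrite (kinj a b) // inE ?eqxx // bs orbT.
by case: ifP => _ //=; rewrite IH.
Qed.

Section InclusionExclusion.
Variables (R : realType) (p : R).

(** Satisfied by the probability that all the edges of some list in [LL] are
    open. As the recurrence shortens [LL], it determines [phi], and so gives the same
    probability to copies of the same lists in different graphs. *)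
Definition incl_excl (E : choiceType) (phi : seq (seq E) -> R) : Prop :=
  phi [::] = 0 /\ forall L LL, phi (L :: LL) =
    p ^+ size (undup L) + phi LL - phi [seq L ++ L' | L' <- LL].

Lemma incl_excl_map (E E' : choiceType) phi phi' (k : E -> E') LL :
  incl_excl phi -> incl_excl phi' -> {in flatten LL &, injective k} ->
  phi LL = phi' [seq map k L | L <- LL].
Proof.
move=> [phi0 phiS] [phi'0 phi'S].
have [n] := ubnP (size LL); elim: n LL => [//|n IH] [|L LL] /=.
  by rewrite phi0 phi'0.
rewrite ltnS => sLL kinj; rewrite phiS phi'S; congr (_ + _ - _).
- rewrite size_undup_map_in // => a b aL bL.
  by apply: kinj; rewrite mem_cat ?aL ?bL.
- by apply: IH => // a b aL bL; apply: kinj; rewrite mem_cat ?aL ?bL orbT.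
rewrite IH ?size_map //; last first.
  have sub : {subset flatten [seq L ++ L' | L' <- LL] <= L ++ flatten LL}.
    move=> a /flattenP[_ /mapP[L' L'L ->]]; rewrite !mem_cat => /orP[->//|aL'].
    by apply/orP; right; apply/flattenP; exists L'.
  by move=> a b /sub aL /sub bL; apply: kinj.
by congr phi'; rewrite -!map_comp; apply: eq_map => L' /=; rewrite map_cat.
Qed.

End InclusionExclusion.

Section Expectation.
Variables (R : realType) (E : finType) (p : R).
Hypothesis p01 : 0 <= p <= 1.
Implicit Types X Y : {set E} -> R.

Lemma expect_le X Y : (forall S, X S <= Y S) ->
  expect_subset p X <= expect_subset p Y.
Proof.
move=> XY; apply: ler_sum => S _; apply: ler_wpM2l => //.
by case/andP: p01 => p0 p1; rewrite mulr_ge0 // exprn_ge0 // subr_ge0.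
Qed.

Lemma expect_eq X Y : X =1 Y -> expect_subset p X = expect_subset p Y.
Proof. by move=> XY; apply: eq_bigr => S _; rewrite XY. Qed.

Lemma expectD X Y : expect_subset p (fun S => X S + Y S) =
  expect_subset p X + expect_subset p Y.
Proof. by rewrite -big_split; apply: eq_bigr => S _; rewrite mulrDr. Qed.

Lemma expectZ a X : expect_subset p (fun S => a * X S) = a * expect_subset p X.
Proof. by rewrite mulr_sumr; apply: eq_bigr => S _; rewrite mulrCA. Qed.

Lemma expect_sum (I : finType) (X : I -> {set E} -> R) :
  expect_subset p (fun S => \sum_i X i S) = \sum_i expect_subset p (X i).
Proof.
rewrite exchange_big; apply: eq_bigr => S _; by rewrite mulr_sumr.
Qed.

(** Expand the product over [e] of [p + (1 - p)], without the term [1 - p] when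
    [e] is in [L]: the factor [p] stands for the presence of [e] in [S]. *)
Lemma expect_subset_of (L : seq E) :
  expect_subset p (fun S => (all (mem S) L)%:R) = p ^+ size (undup L).
Proof.
transitivity (\prod_(e : E) (p + (if e \in L then 0 else 1 - p))); last first.
  rewrite (bigID (mem L)) /= [X in _ * X]big1 ?mulr1 => [|e /negbTE->]; last first.
    by rewrite addrC subrK.
  rewrite (eq_bigr (fun=> p)) => [|e ->]; last by rewrite addr0.
  rewrite prodr_const -(card_uniqP (undup_uniq L)); congr (_ ^+ _).
  by apply: eq_card => e; rewrite mem_undup.
rewrite bigA_distr; apply: eq_bigr => S _.
rewrite (bigID (mem S)) /= (eq_bigr (fun=> p)) => [|e ->//]; rewrite prodr_const.
rewrite -mulrA; congr (_ * _).
case: allP => [LS|LS].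
  rewrite mulr1 -prodr_const (eq_bigl (fun e => e \notin S)) => [|e]; last by rewrite inE.
  apply: eq_bigr => e eS; rewrite (negbTE eS); case: ifP => // /LS eS'.
  by rewrite [_ \in _]eS' in eS.
have [e eL eS] : exists2 e, e \in L & e \notin S.
  apply: contrapT => H; apply: LS => e eL; apply: contrapT => /negP eS.
  by apply: H; exists e.
by rewrite mulr0 (bigD1 e) //= (negbTE eS) eL mul0r.
Qed.

Lemma expect1 : expect_subset p (fun _ : {set E} => 1 : R) = 1.
Proof. by rewrite -[RHS](expr0 p) -(expect_subset_of [::]). Qed.

Lemma expect_card : expect_subset p (fun S : {set E} => #|S|%:R) = p * #|E|%:R.
Proof.
transitivity (expect_subset p (fun S => \sum_(e : E) (all (mem S) [:: e])%:R)).
  apply: expect_eq => S; rewrite -sum1_card natr_sum big_mkcond /=.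
  by apply: eq_bigr => e _ /=; rewrite andbT; case: (e \in S).
rewrite expect_sum (eq_bigr (fun=> p)) => [|e _]; last first.
  by rewrite expect_subset_of /= expr1.
by rewrite sumr_const mulr_natr.
Qed.

Definition contains_some (LL : seq (seq E)) (S : {set E}) : bool :=
  has (fun L => all (mem S) L) LL.

Lemma contains_some_incl_excl : incl_excl p
  (fun LL => expect_subset p (fun S => (contains_some LL S)%:R : R)).
Proof.
split=> [|L LL].
  by rewrite /expect_subset big1 // => S _; rewrite mulr0.
rewrite -expect_subset_of -expectD -mulN1r -expectZ -expectD.
apply: expect_eq => S; rewrite /contains_some /= has_map.
have -> : has (preim (cat L) (fun L' => all (mem S) L')) LL =
    all (mem S) L && has (fun L' => all (mem S) L') LL.
  elim: LL => [|L' LL IH] /=; first by rewrite andbF.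
  by rewrite IH all_cat andb_orr.
by case: all; case: has => /=; ring.
Qed.

End Expectation.

Section Percolation.
Variables (R : realType) (p : R) (d : measure_display).
Variables (Omega : measurableType d) (P : probability Omega R).
Variables (E : choiceType) (opened : Omega -> set E).
Hypothesis perc : bond_percolation P opened p.

Definition open_list (L : seq E) : set Omega :=
  [set w | all (fun e => `[< opened w e >]) L].

Definition open_event (LL : seq (seq E)) : set Omega :=
  [set w | has (fun L => all (fun e => `[< opened w e >]) L) LL].

Lemma open_listE L : open_list L = \big[setI/setT]_(e <- L) [set w | opened w e].
Proof.
elim: L => [|e L IH]; first by rewrite big_nil; apply/seteqP; split.
rewrite big_cons -IH; apply/seteqP; split=> w; rewrite /open_list /=.
  by move=> /andP[/asboolP].
by move=> [we wL]; rewrite wL andbT; apply/asboolP.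
Qed.

Lemma measurable_open_list L : measurable (open_list L).
Proof.
rewrite open_listE; elim: L => [|e L IH]; first by rewrite big_nil.
by rewrite big_cons; apply: measurableI => //; case: perc => + _ _; exact.
Qed.

Lemma open_event_cons L LL :
  open_event (L :: LL) = open_list L `|` open_event LL.
Proof.
apply/seteqP; split=> w; rewrite /open_event /open_list /= -/(has _ LL).
  by move=> /orP.
by move=> ?; apply/orP.
Qed.

Lemma measurable_open_event LL : measurable (open_event LL).
Proof.
elim: LL => [|L LL IH].
  by rewrite (_ : open_event _ = set0) //; apply/seteqP; split.
rewrite open_event_cons; apply: measurableU => //; exact: measurable_open_list.
Qed.

Lemma prob_open_list L : P (open_list L) = (p ^+ size (undup L))%:E.
Proof.
have -> : open_list L = open_list (undup L).
  by apply/seteqP; split=> w; rewrite /open_list /= all_undup.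
rewrite open_listE; case: perc => _ pE ->; last exact: undup_uniq.
rewrite (eq_bigr (fun=> p%:E)) => [|e _]; last by rewrite pE.
elim: (undup L) => [|e L' IH]; first by rewrite big_nil expr0.
by rewrite big_cons IH /= exprS EFinM.
Qed.

Lemma open_event_cat L LL :
  open_list L `&` open_event LL = open_event [seq L ++ L' | L' <- LL].
Proof.
apply/seteqP; split=> w; rewrite /open_event /open_list /= has_map.
  move=> [wL /hasP[L' L'L wL']]; apply/hasP; exists L' => //=.
  by rewrite all_cat wL.
move=> /hasP[L' L'L /=]; rewrite all_cat => /andP[wL wL']; split=> //.
by apply/hasP; exists L'.
Qed.

Lemma open_event_incl_excl : incl_excl p (fun LL => fine (P (open_event LL))).
Proof.
have fin LL : P (open_event LL) \is a fin_num.
  by apply: fin_num_measure; exact: measurable_open_event.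
split=> [|L LL].
  by rewrite (_ : open_event _ = set0) ?measure0 //; apply/seteqP; split.
rewrite open_event_cons measureUfinr; last 3 first.
- exact: measurable_open_list.
- exact: measurable_open_event.
- by rewrite ltey_eq fin.
rewrite open_event_cat.
transitivity (fine (P (open_list L) + P (open_event LL) -
  P (open_event [seq L ++ L' | L' <- LL]))%E); first by [].
by rewrite prob_open_list -(fineK (fin LL)) -(fineK (fin (map _ _))).
Qed.

End Percolation.

(** * Escaping edges *)

Section Escape.
Variables (V E F : choiceType) (G : tiling V E F).

(** Being the start of a self-avoiding walk of length [n] is a local event which
    decreases with [n]; in a locally finite graph, the intersection of these events
    says that the component is infinite. *)
Definition escape (n : nat) (e : E) (S : set E) : Prop :=
  S e /\ exists x s, [/\ endpoint G x e, path.path (adj_in G S) x s,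
    uniq (x :: s) & size s = n].

(** Writes [escape] as a finite union of cylinders, one for each list. *)
Definition escape_list (n : nat) (e : E) (L : seq E) : Prop :=
  exists x s es, [/\ L = e :: es, endpoint G x e, edge_walk G x s es,
    uniq (x :: s) & size s = n].

Lemma escapeE n e S :
  escape n e S <-> exists2 L, escape_list n e L & {in L, forall a, S a}.
Proof.
split=> [[Se [x [s [xe /path_edge_walk[es ws esS] Us sn]]]]|].
  exists (e :: es); first by exists x, s, es.
  by move=> a; rewrite inE => /orP[/eqP->//|/esS].
move=> [_ [x [s [es [-> xe ws Us sn]]]] LS]; split; first by apply: LS; rewrite mem_head.
exists x, s; split=> //; apply/path_edge_walk; exists es => // a aes.
by apply: LS; rewrite inE aes orbT.
Qed.

Lemma escape_le n n' e S : (n <= n')%N -> escape n' e S -> escape n e S.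
Proof.
move=> nn' [Se [x [s [xe ps Us sn]]]]; split=> //.
exists x, (take n s); split => //; first exact: take_path.
  by have := take_uniq n.+1 Us.
by rewrite size_take_min sn; apply/minn_idPl.
Qed.

Variable m : nat.
Hypotheses (simpleG : simple_graph G) (regG : regular_tiling G m).

Lemma finite_escape_list n e :
  exists LL : seq (seq E), forall L, (L \in LL) <-> escape_list n e L.
Proof.
have : finite_set [set L | escape_list n e L].
  pose W x := [set z : seq V * seq E | size z.1 = n /\ edge_walk G x z.1 z.2].
  apply: (@sub_finite_set _ _ (\bigcup_(x in [set x | endpoint G x e])
    ((fun z : seq V * seq E => e :: z.2) @` W x))).
    move=> _ [x [s [es [-> xe ws Us sn]]]]; exists x => //=.
    by exists (s, es).
  apply: bigcup_finite => [|x _].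
    have [u [v [uv H]]] := simpleG.1 e.
    apply: (@sub_finite_set _ _ [set u; v]) => // w /=.
    by rewrite H => /orP[]/eqP; [left|right].
  by apply: finite_image; exact: (finite_walks simpleG regG).
move=> /finite_seqP[LL LLE]; exists LL => L.
by have := congr1 (fun A : set (seq E) => A L) LLE => /= ->.
Qed.

(** An infinite component leaves every ball, and shortening a walk to a vertex
    outside of the ball of radius [n] gives a self-avoiding walk of length more
    than [n]. Conversely a component with [N] vertices has no self-avoiding walk of
    length [N]. *)
Lemma escape_infinite e S :
  in_infinite_component G S e <-> forall n, escape n e S.
Proof.
split=> [[Se [x xe infx]] n|esc].
  split=> //; exists x; apply: contrapT => no; apply: infx.
  apply: sub_finite_set (finite_ball_vertices simpleG regG x n).
  move=> y [s + <-]; case/shortenP => s' ps' Us' _.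
  exists s'; split=> //.
    by apply: path_adj_in_sub ps'.
  rewrite leqNgt; apply/negP => ns'; apply: no; exists (take n s'); split=> //.
  - exact: take_path.
  - by have := take_uniq n.+1 Us'.
  - by rewrite size_take ns'.
have Se : S e by have [] := esc 0%N.
split=> //; apply: contrapT => no.
have fin x : endpoint G x e -> finite_set (component G S x).
  by move=> xe; apply: contrapT => inf; apply: no; exists x.
have bound x : endpoint G x e -> exists N, forall s, path.path (adj_in G S) x s ->
    uniq (x :: s) -> (size s < N)%N.
  move=> /fin/finite_seqP[c cE]; exists (size c) => s ps Us.
  apply: (uniq_leq_size Us) => y /= ys.
  have : component G S x y.
    case/splitPl: ys ps => s1 s2 ls; rewrite cat_path => /andP[ps1 _].
    by exists s1.
  by rewrite cE.
have [u [v [uv H]]] := simpleG.1 e.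
have [Nu bu] := bound u ltac:(by rewrite H eqxx).
have [Nv bv] := bound v ltac:(by rewrite H eqxx orbT).
have [_ [x [s [xe ps Us sn]]]] := esc (Nu + Nv)%N.
move: xe; rewrite H => /orP[]/eqP xE; subst x.
  by have := bu s ps Us; rewrite sn ltnNge leq_addr.
by have := bv s ps Us; rewrite sn ltnNge leq_addl.
Qed.

Section Percolation.
Variables (R : realType) (p : R) (d : measure_display).
Variables (Omega : measurableType d) (P : probability Omega R).
Variable opened : Omega -> set E.
Hypothesis perc : bond_percolation P opened p.

Lemma escape_open_event n e (LL : seq (seq E)) :
  (forall L, (L \in LL) <-> escape_list n e L) ->
  [set w | escape n e (opened w)] = open_event opened LL.
Proof.
move=> LLE; apply/seteqP; split=> w /=.
  move=> /escapeE[L /LLE LL_L LS]; apply/hasP; exists L => //.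
  by apply/allP => a /LS ?; apply/asboolP.
move=> /hasP[L /LLE LL_L /allP LS]; apply/escapeE; exists L => // a /LS.
by move/asboolP.
Qed.

Lemma measurable_escape n e : measurable [set w | escape n e (opened w)].
Proof.
have [LL LLE] := finite_escape_list n e.
rewrite (escape_open_event LLE); exact: measurable_open_event perc _.
Qed.

Lemma escape_cvg0 e :
  P [set w | in_infinite_component G (opened w) e] = 0%E ->
  (fun n => fine (P [set w | escape n e (opened w)])) @ \oo --> (0 : R).
Proof.
move=> P0.
have capE : \bigcap_n [set w | escape n e (opened w)] =
    [set w | in_infinite_component G (opened w) e].
  apply/seteqP; split=> w /=; first by move=> H; apply/escape_infinite => n; exact: H.
  by move=> /escape_infinite H n _; exact: H.
have H : (P \o (fun n => [set w | escape n e (opened w)])) @ \oo --> 0%E.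
  rewrite -P0 -capE; apply: nonincreasing_cvg_mu.
  - by apply: le_lt_trans (probability_le1 P (measurable_escape _ _)) (ltry 1).
  - by move=> n; exact: measurable_escape.
  - by apply: bigcap_measurable => // n _; exact: measurable_escape.
  - move=> n n' nn'; apply/subsetPset => w /=; exact: escape_le.
exact: (fine_cvg H).
Qed.

End Percolation.
End Escape.

Section EscapeTransfer.
Variables (V E F : choiceType) (V' E' F' : finType).
Variables (G : tiling V E F) (G' : tiling V' E' F').
Hypotheses (simpleG : simple_graph G) (simpleG' : simple_graph G').
Variables (m : nat) (regG : regular_tiling G m) (regG' : regular_tiling G' m).
Variables (z : V') (t : nat) (x0 : V).
Variables (h : V' -> V) (k : E' -> E) (l : F' -> F).
Hypothesis iso : piece_isomorphism G' G
  (ball_vertices G' z t) (ball_edges G' z t) (ball_faces G' z t)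
  (ball_vertices G x0 t) (ball_edges G x0 t) (ball_faces G x0 t) h k l.
Variable n : nat.
Hypothesis nt : (n < t)%N.
Variable e' : E'.
Hypothesis ze' : endpoint G' z e'.

Lemma endpoint_ball1 x : endpoint G' x e' -> ball_vertices G' z 1 x.
Proof.
move=> xe; case: (eqVneq z x) => [<-|zx]; first exact: ball_vertices_center.
apply: (@ball_vertices_step _ _ _ G' z 0 z); first exact: ball_vertices_center.
by apply/adjP; exists e'; rewrite /joins zx ze'.
Qed.

Lemma escape_list_map L : escape_list G' n e' L ->
  escape_list G n (k e') (map k L) /\ {in L, forall a, ball_edges G' z t a}.
Proof.
move=> [x [s [es [-> xe ws Us sn]]]].
have x1 := endpoint_ball1 xe.
have nt1 : (1 + size s <= t)%N by rewrite sn add1n.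
have Hs := edge_walk_ball nt1 x1 ws.
have Hes := edge_walk_edges simpleG' Hs ws.
have Be : ball_edges G' z t e'.
  by move=> y /endpoint_ball1; apply: ball_vertices_le; apply: leq_trans nt.
have kinj : {in x :: s &, injective h}.
  case: (iso) => /set_bijP[_ hinj _] _ _ _ _ a b /Hs Aa /Hs Ab; exact: hinj.
split; last by move=> a; rewrite inE => /orP[/eqP->//|/Hes].
exists (h x), (map h s), (map k es); split=> //=.
- by case: (iso) => _ _ _ -> //; apply: Hs; rewrite mem_head.
- by rewrite (piece_edge_walk iso).
- by rewrite -[_ && _]/(uniq (map h (x :: s))) map_inj_in_uniq.
- by rewrite size_map.
Qed.

Variables (R : realType) (p : R) (d : measure_display).
Variables (Omega : measurableType d) (P : probability Omega R).
Variable opened : Omega -> set E.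
Hypothesis perc : bond_percolation P opened p.

(** All the walks of length [n] from [e'] lie in the chart, so that the lists of
    edges which make [e'] escape are copies of lists which make its image escape.
    *)
Lemma expect_escape_le : 0 <= p <= 1 ->
  expect_subset p (fun S : {set E'} => (`[< escape G' n e' [set` S] >])%:R : R) <=
  fine (P [set w | escape G n (k e') (opened w)]).
Proof.
move=> p01.
have [LL' LLE'] := finite_escape_list simpleG' regG' n e'.
have [LL LLE] := finite_escape_list simpleG regG n (k e').
rewrite (escape_open_event _ LLE).
rewrite (@expect_eq _ _ _ _ (fun S => (contains_some LL' S)%:R)) => [|S]; last first.
  congr ((nat_of_bool _)%:R); apply/asboolP/hasP.
    move=> /escapeE[L /LLE' LL_L LS]; exists L => //; exact/allP.
  move=> [L /LLE' LL_L /allP LS]; apply/escapeE; exists L => //.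
rewrite (incl_excl_map (k := k) (contains_some_incl_excl E' p) (open_event_incl_excl perc)).
  apply: fine_le.
  - by apply: fin_num_measure; exact: measurable_open_event perc _.
  - by apply: fin_num_measure; exact: measurable_open_event perc _.
  apply: le_measure; rewrite ?inE; try exact: measurable_open_event perc _.
  move=> w /hasP[_ /mapP[L /LLE' L_L ->] wL]; apply/hasP; exists (map k L) => //.
  by apply/LLE; case: (escape_list_map L_L).
have Hb a : a \in flatten LL' -> ball_edges G' z t a.
  by move=> /flattenP[L /LLE' /escape_list_map[_ H] /H].
move=> a b /Hb Ba /Hb Bb; case: (iso) => _ /set_bijP[_ kinj _] _ _ _.
exact: kinj.
Qed.

End EscapeTransfer.

(** * Bounds on a finite tiling *)

Lemma face_sum_seq (V E F : finType) (G : tiling V E F) (fs : seq F) :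
  exists y, forall e, face_sum G y e = bit (face_parity G fs e).
Proof.
elim: fs => [|f fs [y yE]].
  by exists (fun=> 0) => e; rewrite /face_sum big1 // => f _; rewrite mul0r.
exists (fun g => bit (g == f) + y g) => e.
rewrite /face_parity /= oddD bitD oddb -[bit (odd _)]yE /face_sum.
under eq_bigr do rewrite mulrDl.
rewrite big_split /= (bigD1 f) //= eqxx mul1r big1 ?addr0 // => g gf.
by rewrite (negbTE gf) mul0r.
Qed.

Lemma edge_count (V E F : finType) (G : tiling V E F) m :
  simple_graph G -> regular_tiling G m -> (m * #|V| = 2 * #|E|)%N.
Proof.
move=> simpleG regG.
have : (\sum_v \sum_e endpoint G v e = \sum_e \sum_v endpoint G v e)%N.
  by rewrite exchange_big.
rewrite (eq_bigr (fun=> m)) => [|v _]; last first.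
  have [s [Us ss sE]] := regular_edges v regG.
  rewrite -ss -(card_uniqP Us) -sum1_card [RHS]big_mkcond /=.
  by apply: eq_bigr => e _; rewrite -sE; case: (e \in s).
rewrite [RHS](eq_bigr (fun=> 2%N)) => [|e _]; last first.
  have [u [v [uv H]]] := simpleG.1 e.
  rewrite (bigD1 u) //= (bigD1 v) /=; last by rewrite eq_sym.
  rewrite !H !eqxx orbT big1 // => w /andP[wu wv].
  by rewrite H (negbTE wu) (negbTE wv).
by rewrite !sum_nat_const mulnC => ->; rewrite mulnC.
Qed.

Lemma self_dual_connected (V E F : choiceType) (G : tiling V E F) :
  self_dual G -> connected_tiling G -> connected_tiling (dual G).
Proof.
move=> [h [k [l iso]]] conn f g.
case: (iso) => /set_bijP[_ _ hsurj] _ _ _ _.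
have [x _ <-] := hsurj f I; have [y _ <-] := hsurj g I.
have [s ps <-] := conn x y; exists (map h s); last by rewrite last_map.
elim: s x ps => [|v s IH] x //= /andP[xv /IH ps]; rewrite ps andbT.
by rewrite (isomorphism_adj iso).
Qed.

Section Approximation.
Variables (m : nat) (V E F : choiceType) (G : tiling V E F).
Hypotheses (hm : (5 <= m)%N) (hypG : hyperbolic_tiling m G).
Variables (x0 : V) (e0 : E).
Hypothesis x0e0 : endpoint G x0 e0.
Variables (V' E' F' : finType) (G' : tiling V' E' F') (t n r : nat).
Hypothesis surfG' : surface_tiling G'.
Hypothesis regG' : regular_tiling G' m.
Hypothesis regD : faces_of_length G' m.
Hypothesis etransG' : edge_transitive G'.
Hypothesis sdG' : self_dual G'.
Hypothesis ballG' : forall x y, isomorphic_balls G' G t x y.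
Hypothesis rP : forall x s,
  path.path (adj G) x s -> last x s = x ->
  {in x :: s, forall v, ball_vertices G x0 n v} ->
  exists2 fs, {in fs, forall f, ball_faces G x0 r f} &
    trace G x s =1 face_parity G fs.
Hypotheses (nt : (n < t)%N) (rt : (r <= t)%N).

Let simpleG : simple_graph G. Proof. by case: hypG => -[[]]. Qed.
Let regG : regular_tiling G m. Proof. by case: hypG. Qed.
Let simpleG' : simple_graph G'. Proof. by case: surfG'. Qed.
Let simpleD : simple_graph (dual G'). Proof. by case: surfG'. Qed.

Lemma rooted_chart e' : exists z h k l, [/\ endpoint G' z e', piece_isomorphism G' G
  (ball_vertices G' z t) (ball_edges G' z t) (ball_faces G' z t)
  (ball_vertices G x0 t) (ball_edges G x0 t) (ball_faces G x0 t) h k l,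
  h z = x0 & k e' = e0].
Proof.
have [u [_ _]] := edge_joins simpleG' e'.
apply: (rooted_ball_isomorphism _ simpleG regG regG' etransG' _ (ballG' u x0) x0e0).
exact: leq_trans nt.
Qed.

Definition escaping (S : {set E'}) : {set E'} :=
  [set e in S | `[< escape G' n e [set` S] >]]%SET.

Lemma confined_ball (S : {set E'}) z e' w s : e' \in S -> e' \notin escaping S ->
  endpoint G' z e' -> path.path (adj_in G' [set` S]) z s -> last z s = w ->
  ball_vertices G' z n w.
Proof.
move=> e'S; rewrite inE e'S => /asboolPn esc ze' + <-.
case/shortenP => s' ps' Us' _; exists s'; split=> //.
  by apply: path_adj_in_sub ps'.
rewrite leqNgt; apply/negP => ns'; apply: esc; split=> //.
exists z, (take n s'); split=> //.
- exact: take_path.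
- by have := take_uniq n.+1 Us'.
- by rewrite size_take ns'.
Qed.

(** If the first edge of a closed walk in [S] does not escape, the walk stays in
    the ball of radius [n] around an end of this edge. A chart carries it to [G],
    where it is filled by faces of the ball of radius [r], and the chart carries
    these faces back. *)
Lemma confined_filling (S : {set E'}) x s :
  path.path (adj_in G' [set` S :\: escaping S]%SET) x s -> last x s = x ->
  exists y, forall e, face_sum G' y e = bit (trace G' x s e).
Proof.
case: s => [|v s].
  by exists (fun=> 0) => e; rewrite /face_sum big1 // => f _; rewrite mul0r.
move=> ps ls.
have pS : path.path (adj_in G' [set` S]) x (v :: s).
  by apply: path_adj_in_sub ps => a /=; rewrite inE => /andP[].
have [e' e'T xve'] : exists2 e', e' \in (S :\: escaping S)%SET & joins G' x v e'.
  by case/andP: ps => /adj_inP[e' e'T xve'] _; exists e'.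
move: e'T; rewrite finset.in_setD => /andP[e'B e'S].
have [z [h [k [l [ze' iso hz ke']]]]] := rooted_chart e'.
have zx : exists2 s', path.path (adj_in G' [set` S]) z s' & last z s' = x.
  move: ze'; rewrite (joins_endpoint simpleG' _ xve') => /orP[]/eqP->.
    by exists [::].
  exists [:: x] => //=; rewrite andbT adj_in_sym.
  by apply/adj_inP; exists e'.
have walk_n : {in x :: v :: s, forall w, ball_vertices G' z n w}.
  move=> w ws; case/splitPl: ws pS => s1 s2 ls1; rewrite cat_path => /andP[ps1 _].
  have [s' ps' ls'] := zx.
  apply: (confined_ball e'S e'B ze' (s := s' ++ s1)).
    by rewrite cat_path ps' ls'.
  by rewrite last_cat ls'.
have walk_t : {in x :: v :: s, forall w, ball_vertices G' z t w}.
  by move=> w /walk_n; apply: ball_vertices_le; exact: ltnW.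
have [es ws _] : exists2 es, edge_walk G' x (v :: s) es & {in es, forall a, setT a}.
  by apply/path_edge_walk; exact: path_adj_in_sub pS.
have es_t : {in es, forall a, ball_edges G' z t a}.
  exact: (edge_walk_edges simpleG' walk_t ws).
have [|||fs fsr trE] := rP (x := h x) (s := map h (v :: s)).
- have : edge_walk G (h x) (map h (v :: s)) (map k es).
    by rewrite (piece_edge_walk iso).
  by move=> ws'; apply/path_edge_walk; exists (map k es).
- by rewrite last_map ls.
- move=> _ /(mapP (s := x :: v :: s))[w ws' ->].
  have [s' [/path_edge_walk[es' wes' _] ls' ss']] := walk_n w ws'.
  have st : (0 + size s' <= t)%N by rewrite add0n (leq_trans ss') // ltnW.
  have Hs' := edge_walk_ball st (ball_vertices_center G' z 0) wes'.
  have Hes' := edge_walk_edges simpleG' Hs' wes'.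
  exists (map h s'); split; last by rewrite size_map.
    apply/path_edge_walk; exists (map k es') => //.
    by rewrite -hz (piece_edge_walk iso).
  by rewrite -hz last_map ls'.
have /choice[g gP] : forall f, exists f', f \in fs -> ball_faces G' z t f' /\ l f' = f.
  move=> f; case: (boolP (f \in fs)) => [ffs|_]; last first.
    have [u [_ _]] := edge_joins simpleD e'.
    by exists u.
  have [_ _ /set_bijP[_ _ lsurj] _ _] := iso.
  have [|f' f't f'E] := lsurj f; last by exists f'.
  by apply: ball_faces_le rt _ _; exact: fsr.
have [y yE] := face_sum_seq G' (map g fs); exists y => e''; rewrite yE.
congr bit; case: (pselect (ball_edges G' z t e'')) => [Be''|Ne''].
  rewrite -(piece_trace iso walk_t Be'') trE /face_parity count_map.
  congr odd; apply: eq_in_count => f /gP[gt gl] /=.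
  by case: iso => _ _ _ _ sideE; rewrite -sideE // gl.
(* Outside of the chart there is no edge of the walk nor of the faces. *)
have -> : trace G' x (v :: s) e'' = false.
  by apply/negP => /(trace_ball_edges simpleG' walk_t).
rewrite /face_parity count_map (@eq_in_count _ _ pred0) ?count_pred0 //.
by move=> f /gP[gt _] /=; apply/negP => /gt.
Qed.

(** The dimension of the cycles of [S] modulo boundaries is at least 0 and at
    most the number of escaping edges. *)
Lemma homology_bounds (S : {set E'}) :
  (#|F'| + graph_rank G' S <= #|S| + graph_rank (dual G') (~: S)%SET + 1)%N /\
  (#|S| + graph_rank (dual G') (~: S)%SET <=
     #|F'| + graph_rank G' S + #|escaping S|)%N.
Proof.
split.
  apply: rank_gap_lower => //; first by case: surfG'.
  by apply: self_dual_connected => //; case: surfG'.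
apply: rank_gap_upper => c cS c0.
apply: (@cycle_filling _ _ _ _ simpleG' (S :\: escaping S)%SET) => //.
  exact: confined_filling.
by move=> e /cS; rewrite finset.in_setD andbC.
Qed.

Lemma card_ball_le (v0 : V') (s : seq V) : uniq s ->
  {in s, forall v, ball_vertices G x0 t v} -> (size s <= #|V'|)%N.
Proof.
move=> Us st; have [h [k [l iso]]] := ballG' v0 x0.
have /choice[g gP] : forall v, exists v', v \in s -> h v' = v.
  move=> v; case: (boolP (v \in s)) => [vs|_]; last by exists v0.
  case: (iso) => /set_bijP[_ _ hsurj] _ _ _ _.
  by have [|v' _ v'E] := hsurj v; [exact: st|exists v'].
rewrite -(size_map g) cardE; apply: uniq_leq_size => [|v' _]; last first.
  by rewrite mem_enum.
by rewrite map_inj_in_uniq // => a b /gP ga /gP gb gab; rewrite -ga -gb gab.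
Qed.

Section Expect.
Variables (R : realType) (p : R) (d : measure_display).
Variables (Omega : measurableType d) (P : probability Omega R).
Variable opened : Omega -> set E.
Hypothesis perc : bond_percolation P opened p.
Hypothesis p01 : 0 <= p <= 1.
Let X (S : {set E'}) : R :=
  ((graph_rank (dual G') (~: S)%SET)%:R - (graph_rank G' S)%:R) / #|E'|%:R.
Hypothesis E'0 : (0 < #|E'|)%N.

Let faces_ratio : #|F'|%:R / #|E'|%:R = 2 / m%:R :> R.
Proof.
have := edge_count simpleD regD => /(congr1 (fun a => a%:R : R)).
rewrite !natrM => H; apply/eqP; rewrite eqr_div ?pnatr_eq0 -?lt0n //; last first.
  by apply: leq_trans hm.
by rewrite mulrC H mulrC.
Qed.

Let En0 : #|E'|%:R != 0 :> R. Proof. by rewrite pnatr_eq0 -lt0n. Qed.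

Lemma expect_lower : 2 / m%:R - p - #|E'|%:R^-1 <= expect_subset p X.
Proof.
have -> : 2 / m%:R - p - #|E'|%:R^-1 = expect_subset p (fun S : {set E'} =>
    #|E'|%:R^-1 * ((#|F'|%:R - 1) * 1 + (-1) * #|S|%:R)).
  rewrite expectZ expectD !expectZ (expect1 _ p) (expect_card _ p).
  by rewrite -faces_ratio; field.
apply: expect_le => // S; rewrite /X [leRHS]mulrC ler_pM2l ?invr_gt0 ?ltr0n //.
have [+ _] := homology_bounds S; rewrite -(ler_nat R) !natrD; lra.
Qed.

Lemma expect_upper :
  expect_subset p X <= 2 / m%:R - p + fine (P [set w | escape G n e0 (opened w)]).
Proof.
set q := fine _.
have card_esc : expect_subset p (fun S : {set E'} => #|escaping S|%:R) <= #|E'|%:R * q.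
  apply: (@le_trans _ _ (expect_subset p (fun S : {set E'} =>
      \sum_(e : E') (`[< escape G' n e [set` S] >])%:R))).
    apply: expect_le => // S; rewrite -sum1_card natr_sum big_mkcond /=.
    apply: ler_sum => e _; rewrite inE; case: (e \in S) => //=.
    by case: asboolP.
  rewrite expect_sum mulr_natl -sumr_const.
  apply: ler_sum => e _; have [z [h [k [l [ze iso hz ke]]]]] := rooted_chart e.
  rewrite /q -ke; exact: (expect_escape_le simpleG simpleG' regG regG' iso nt ze perc p01).
apply: (@le_trans _ _ (expect_subset p (fun S : {set E'} =>
    #|E'|%:R^-1 * (#|F'|%:R * 1 + ((-1) * #|S|%:R + #|escaping S|%:R))))).
  apply: expect_le => // S; rewrite /X [leLHS]mulrC ler_pM2l ?invr_gt0 ?ltr0n //.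
  have [_ +] := homology_bounds S; rewrite -(ler_nat R) !natrD; lra.
rewrite expectZ !expectD !expectZ (expect1 _ p) (expect_card _ p).
rewrite -faces_ratio mulr1 mulN1r !mulrDr mulrN (mulrC p) mulKf // (mulrC _^-1) -addrA.
by rewrite !lerD2l mulrC ler_pdivrMr ?ltr0n // mulrC.
Qed.

End Expect.

End Approximation.

(** * The rank difference function where the percolation is finite *)

(** The expected fraction of escaping edges tends to 0 with [n], and the fraction
    [1 / #|E_t|] lost to the sum of all faces tends to 0 with [t]. *)
Lemma rank_difference_subcritical (R : realType) (m : nat) (hm : (5 <= m)%N)
  (V E F : choiceType) (G : tiling V E F) (hG : hyperbolic_tiling m G) (e : E)
  (d : measure_display) (Omega : measurableType d) (p : R)
  (P : probability Omega R) (opened : Omega -> set E)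
  (gT : nat -> finGroupType) (a b : forall t, gT t) :
  0 <= p <= 1 -> bond_percolation P opened p -> approximating_family m G a b ->
  P [set w | in_infinite_component G (opened w) e] = 0%E ->
  rank_difference a b p = 2 / m%:R - p.
Proof.
move=> p01 perc hT P0.
have simpleG : simple_graph G by case: hG => -[[]].
have regG : regular_tiling G m by case: hG.
have [x0 [y0 /and3P[_ x0e _]]] := edge_joins simpleG e.
rewrite /rank_difference; set u := (fun t : nat => _).
suff ucvg : u @ \oo --> 2 / m%:R - p by rewrite (cvg_limn_inf_sup ucvg).
apply/cvgrPdist_le => eps eps0.
have := escape_cvg0 simpleG regG perc P0.
move=> /cvgrPdist_le /(_ _ eps0) [n _ /(_ n (leqnn n))] /=.
rewrite sub0r normrN => /(le_trans (ler_norm _)) qn.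
have [r rP] := ball_filling hG x0 n.
pose N := (Num.truncn eps^-1).+1.
have Neps : N%:R^-1 <= eps.
  rewrite -[leRHS]invrK lef_pV2 ?posrE ?invr_gt0 ?ltr0n //.
  by apply/ltW; rewrite truncnS_gt.
have [rN [s [Us sN] sP]] := infinite_balls hG x0 N.
(* Beyond this [t], the tiling is in the family, the walks of length [n] and
   their fillings lie in the charts, and the charts have [N] vertices. *)
exists (m + n.+1 + r + rN)%N => // t /= tbig.
have mt : (m <= t)%N by lia.
have nt : (n < t)%N by lia.
have rt : (r <= t)%N by lia.
have rNt : (rN <= t)%N by lia.
have surf := approx_surface hT mt.
have reg := approx_regular hT mt.
have regD := approx_faces hT mt.
have etr := approx_edge_transitive hT mt.
have sd := approx_self_dual hT mt.
have balls := approx_balls hT mt.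
have simp : simple_graph (coset_tiling (a t) (b t)) by case: surf.
have v0 : left_coset <[a t]>%g.
  exists (<[a t]>%g : {set gT t}); apply/lcosetsP; exists 1%g; first by rewrite inE.
  by rewrite mul1g.
have NV : (N <= #|{: left_coset <[a t]>%g}|)%N.
  rewrite -sN; apply: (card_ball_le balls v0 Us) => v vs.
  exact: ball_vertices_le rNt _ (sP v vs).
have NE : (N <= #|{: left_coset <[(a t * b t)%g]>%g}|)%N.
  have := edge_count simp reg; nia.
have E0 : (0 < #|{: left_coset <[(a t * b t)%g]>%g}|)%N by exact: leq_trans NE.
have up := expect_upper hm hG x0e surf reg regD etr sd balls rP nt rt perc p01 E0.
have low := expect_lower hm hG x0e surf reg regD etr sd balls rP nt rt p01 E0.
have NEinv : #|{: left_coset <[(a t * b t)%g]>%g}|%:R^-1 <= eps.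
  apply: le_trans Neps; rewrite lef_pV2 ?posrE ?ltr0n // ler_nat //.
rewrite ler_norml; apply/andP; split.
  rewrite lerBrDr; move: up; rewrite -/(u t); lra.
move: low; rewrite -/(u t); lra.
Qed.

Theorem corollary4p6 (R : realType) (m : nat) (hm : (5 <= m)%N)
  (V E F : choiceType) (G : tiling V E F) (hG : hyperbolic_tiling m G)
  (e : E)
  (d : measure_display) (Omega : measurableType d)
  (P : R -> probability Omega R) (opened : Omega -> set E)
  (hP : forall p : R, 0 <= p <= 1 -> bond_percolation (P p) opened p)
  (gT : nat -> finGroupType) (a b : forall t, gT t)
  (hT : approximating_family m G a b) :
  critical_probability P G opened e <= homological_threshold R m a b.
Proof.
rewrite /critical_probability /homological_threshold.
set A := [set p | _]; set H := [set p | _].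
have AH : A `<=` H.
  move=> p [p01 P0]; split=> //.
  by rewrite (rank_difference_subcritical hm hG p01 (hP p p01) hT P0) subrKA subrr.
have ubH : ubound H 1 by move=> p [/andP[]].
have supH p : H p -> p <= sup H by apply: ub_le_sup; exists 1.
have [A0|/nonemptyPn A0] := pselect (A !=set0).
  by apply: ge_sup => // p /AH /supH.
rewrite A0 sup0; have [[p Hp]|/nonemptyPn ->] := pselect (H !=set0); last by rewrite sup0.
by apply: le_trans (supH p Hp); case: Hp => /andP[].
Qed.
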